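(* Let $p\in(2,6)$ and $\beta=\frac{p-2}{6-p}$. There exists $\varepsilon>0$ such that the following holds: if $\mathcal K$ is any compact metric graph, $\mathcal G$ is the graph obtained by attaching one halfline to $\mathcal K$, and $\mu>0$ satisfies $$\mu^\beta\,\mathrm{diam}(\mathcal K)+\frac1{\mu^\beta\,\mathrm{length}(\mathcal K)}<\varepsilon,$$ then $\mathcal G$ has no ground state of mass $\mu$.
   Context: A compact metric graph has finitely many vertices and finitely many bounded edges, each identified with an interval $[0,\ell_e]$; $\mathrm{length}(\mathcal K)=\sum_e\ell_e$ is its total length and $\mathrm{diam}(\mathcal K)$ its diameter with respect to the path distance. $H^1_\mu(\mathcal G)$: continuous functions on $\mathcal G$, $H^1$ on each edge, with $\int_{\mathcal G}|u|^2=\mu$. $E(u,\mathcal G)=\frac12\int_{\mathcal G}|u'|^2-\frac1p\int_{\mathcal G}|u|^p$; a ground state of mass $\mu$ is a minimizer of $E(\cdot,\mathcal G)$ on $H^1_\mu(\mathcal G)$. *)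

(* Defs.v *)
From HB Require Import structures.
From mathcomp Require Import all_boot all_order all_algebra.
From mathcomp Require Import all_classical all_reals all_analysis.
Set Implicit Arguments. Unset Strict Implicit. Unset Printing Implicit Defensive.
Import Order.TTheory GRing.Theory Num.Theory.
Import numFieldNormedType.Exports.
Local Open Scope classical_set_scope.
Local Open Scope ring_scope.

Section MetricGraphs.
Variable R : realType.

(* A compact metric graph: finitely many vertices 'I_nv, finitely many
   bounded edges 'I_ne; edge e is identified with [0, len e], its point 0
   being the vertex src e and its point len e being the vertex dst e.
   Loops and multiple edges are allowed.  A metric graph is connected. *)
Record cgraph := CGraph {
  nv : nat;
  ne : nat;
  src : 'I_ne -> 'I_nv;
  dst : 'I_ne -> 'I_nv;
  len : 'I_ne -> R;
  len_pos : forall e, 0 < len e;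
  ne_pos : (0 < ne)%N;
  walk_connected : forall v w : 'I_nv,
    exists s : seq ('I_ne * bool),
      (fix ok (a : 'I_nv) (s : seq ('I_ne * bool)) : Prop :=
         match s with
         | [::] => a = w
         | eb :: s' => (if eb.2 then src eb.1 else dst eb.1) = a /\
                       ok (if eb.2 then dst eb.1 else src eb.1) s'
         end) v s
}.

Variable K : cgraph.

Fixpoint walk_ok (a b : 'I_(nv K)) (s : seq ('I_(ne K) * bool)) : Prop :=
  match s with
  | [::] => a = b
  | eb :: s' => (if eb.2 then src eb.1 else dst eb.1) = a /\
                walk_ok (if eb.2 then dst eb.1 else src eb.1) b s'
  end.

Definition walk_len (s : seq ('I_(ne K) * bool)) : R :=
  \sum_(eb <- s) len eb.1.

Definition vdist (v w : 'I_(nv K)) : R :=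
  inf [set r | exists s, walk_ok v w s /\ r = walk_len s].

Definition is_point (P : 'I_(ne K) * R) : Prop := 0 <= P.2 <= len P.1.

Definition pdist (P Q : 'I_(ne K) * R) : R :=
  let ends (P : 'I_(ne K) * R) := [:: (src P.1, P.2); (dst P.1, len P.1 - P.2)] in
  let through := [seq a.2 + vdist a.1 b.1 + b.2 | a <- ends P, b <- ends Q] in
  let cands := if P.1 == Q.1 then `|P.2 - Q.2| :: through else through in
  inf [set r | r \in cands].

Definition diam : R :=
  sup [set d | exists P Q, is_point P /\ is_point Q /\ d = pdist P Q].

Definition length : R := \sum_(e < ne K) len e.

(* a function on G = K with a halfline [0,+oo) attached at vertex v0,
   together with (weak) derivatives on each edge *)
Record gfun := GFun {
  fe : 'I_(ne K) -> R -> R;   (* u restricted to edge e, on [0, len e] *)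
  de : 'I_(ne K) -> R -> R;   (* its weak derivative *)
  fh : R -> R;                (* u restricted to the halfline, on [0,+oo) *)
  dh : R -> R                 (* its weak derivative *)
}.

Definition mu := (@lebesgue_measure R).
Definition hl : set R := `[0, +oo[.

(* H^1(G): H^1 on each edge (and on the halfline), continuous on G *)
Definition H1 (v0 : 'I_(nv K)) (u : gfun) : Prop :=
  (forall e,
     measurable_fun `[0, len e] (de u e) /\
     mu.-integrable `[0, len e] (fun x => ((de u e x) ^+ 2)%:E) /\
     (forall x, 0 <= x <= len e ->
        fe u e x = fe u e 0 + Rintegral mu `[0, x] (de u e))) /\
  (measurable_fun hl (dh u) /\
   mu.-integrable hl (fun x => ((dh u x) ^+ 2)%:E) /\
   measurable_fun hl (fh u) /\
   mu.-integrable hl (fun x => ((fh u x) ^+ 2)%:E) /\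
   (forall x, 0 <= x -> fh u x = fh u 0 + Rintegral mu `[0, x] (dh u))) /\
  (exists phi : 'I_(nv K) -> R,
     (forall e, fe u e 0 = phi (src e) /\ fe u e (len e) = phi (dst e)) /\
     fh u 0 = phi v0).

Definition mass (u : gfun) : R :=
  \sum_(e < ne K) Rintegral mu `[0, len e] (fun x => fe u e x ^+ 2)
  + Rintegral mu hl (fun x => fh u x ^+ 2).

Definition energy (p : R) (u : gfun) : R :=
  2^-1 * (\sum_(e < ne K) Rintegral mu `[0, len e] (fun x => de u e x ^+ 2)
          + Rintegral mu hl (fun x => dh u x ^+ 2))
  - p^-1 * (\sum_(e < ne K) Rintegral mu `[0, len e] (fun x => powR `|fe u e x| p)
            + Rintegral mu hl (fun x => powR `|fh u x| p)).

Definition ground_state (v0 : 'I_(nv K)) (p m : R) (u : gfun) : Prop :=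
  H1 v0 u /\ mass u = m /\
  forall w : gfun, H1 v0 w -> mass w = m -> energy p u <= energy p w.

End MetricGraphs.

(* Main.v *)
Require Import Defs.
From HB Require Import structures.
From mathcomp Require Import all_boot all_order all_algebra.
From mathcomp Require Import all_classical all_reals all_analysis.
From mathcomp Require Import measurable_realfun ring lra.
Import Order.TTheory GRing.Theory Num.Theory.
Import numFieldNormedType.Exports.
Set Implicit Arguments. Unset Strict Implicit. Unset Printing Implicit Defensive.
Local Open Scope classical_set_scope.
Local Open Scope ring_scope.

(* Let [level] be the infimum of the energy over the functions of mass 1 on the
   halfline that vanish at the origin.  Extending such functions by zero on K
   shows that a ground state u of mass m has energy at most level * m ^ gamma,
   gamma = 2 beta + 1.  A Gagliardo-Nirenberg inequality then bounds its kinetic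
   energy by a multiple of m ^ gamma.  As the diameter of K is small, u is almost
   constant on K, and as K is long, it is almost zero there: u ^ 2 is bounded on
   K by a small multiple of (mass on K) + (kinetic energy on K), suitably scaled.
   Hence the restriction of u to the halfline can be prolonged by a short ramp to
   a function vanishing at the origin, at a cost that is negligible compared with
   the kinetic energy on K and with what is lost by not using the mass on K
   (level < 0 and gamma >= 1).  This forces u = 0 on K, so that the level is
   attained on the halfline by a function vanishing at the origin; cutting that
   function near the origin and prolonging it by a ramp lowers its energy, a
   contradiction. *)

(** The constants may depend neither on the number of edges nor on the shape of K, so edgewise
    estimates are summed only into the total mass and the total kinetic energy. This is why two
    points of K are compared along a walk that uses no edge twice. With [k = m ^ beta], the natural
    units are [1 / k] for length, [m * k] for [u ^ 2] and [m * k ^ 2] for energy; in these units the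
    hypothesis says that K has small diameter and large length, and [m] disappears from the
    argument. Gagliardo-Nirenberg is kept as the family [u ^ 2 <= t * mass + kinetic / t], with [t]
    chosen last, because the right-hand side is additive over edges, unlike the product form. It
    closes into a bound on the kinetic energy because [q = (p - 2) / 2 < 2], that is, [p < 6]. What
    prolonging the halfline part costs is linear in the mass and kinetic energy on K with
    coefficients that become small with [eps]; what it gains is linear with fixed coefficients.
    Optimal profiles never enter: the sign of the level and its scaling suffice. *)

Section Integrals.
Variable R : realType.
Local Notation mu := (@lebesgue_measure R).
Implicit Types (f g : R -> R) (D : set R).

Lemma Rintegral_cat f (a b : R) (t : itv_bound R) : a <= b -> (BRight b <= t)%O ->
  mu.-integrable [set` Interval (BLeft a) t] (EFin \o f) ->
  Rintegral mu [set` Interval (BLeft a) t] f =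
  Rintegral mu `[a, b] f + Rintegral mu [set` Interval (BLeft b) t] f.
Proof.
move=> ab bt fi; apply/eqP; rewrite addrC -subr_eq; apply/eqP.
rewrite Rintegral_itvB//.
rewrite Rintegral_itv_obnd_cbnd//.
apply: integrableS fi => //; apply: subset_itvr; rewrite bnd_simp//.
Qed.

Lemma measurable_affine (b c : R) : measurable_fun setT (fun x : R => b * x + c).
Proof.
by apply: measurable_funD => //; apply: measurable_funM.
Qed.

(** The pushforward of Lebesgue measure under the affine map, multiplied by [b], agrees with
    Lebesgue measure on half-open intervals; uniqueness does the rest. *)
Lemma affine_measure (b c : R) (b0 : 0 < b) (A : set R) : measurable A ->
  mu A = (b%:E * mu ((fun x => b * x + c)%R @^-1` A))%E.
Proof.
move=> mA; set phi := fun x => _.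
have mphi : measurable_fun setT (phi : R -> measurableTypeR R) by exact: measurable_affine.
pose bn : {nonneg R} := NngNum (ltW b0).
pose pf := measure_function_pushforward__canonical__measure_function_Measure mu mphi.
pose nu : {measure set (measurableTypeR R) -> \bar R} := mscale bn pf.
have -> : (b%:E * mu (phi @^-1` A) = nu A)%E by [].
apply: (@lebesgue_measure_unique R nu) => // X -[[x y] /= _ <-].
rewrite /nu /= /mscale /= /pushforward.
have -> : phi @^-1` `]x, y] = [set` `](x - c) / b, (y - c) / b]].
  apply/seteqP; split => z /=; rewrite !in_itv/= /phi ltr_pdivrMr// ler_pdivlMr//;
   rewrite ltrBlDr lerBrDr (mulrC z) //.
rewrite !lebesgue_measure_itv/= !lte_fin ltr_pM2r ?invr_gt0// ltrD2r.
case: ifP => xy; last by rewrite mule0.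
by rewrite -EFinD -EFinM; congr EFin; field; rewrite gt_eqF.
Qed.

Lemma affine_ge0_integral (b c : R) (b0 : 0 < b) D (f : R -> \bar R) : measurable D ->
  measurable_fun D f -> (forall x, D x -> (0 <= f x)%E) ->
  (\int[mu]_(x in D) f x = b%:E * \int[mu]_(x in (fun x => b * x + c)%R @^-1` D) f (b * x + c)%R)%E.
Proof.
move=> mD mf f0; pose phi x : R := b * x + c.
have mphi : measurable_fun setT (phi : R -> measurableTypeR R) by exact: measurable_affine.
pose bn : {nonneg R} := NngNum (ltW b0).
pose pf := measure_function_pushforward__canonical__measure_function_Measure mu mphi.
pose nu : {measure set (measurableTypeR R) -> \bar R} := mscale bn pf.
have -> : (\int[mu]_(x in D) f x = \int[nu]_(x in D) f x)%E.
  apply: eq_measure_integral => A mA _.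
  exact: (affine_measure c b0 mA).
rewrite /nu ge0_integral_mscale//=; congr (_ * _)%E.
rewrite /pf ge0_integral_pushforward// => y; rewrite inE; exact: f0.
Qed.

Lemma measurable_affine_preimage (b c : R) D : measurable D ->
  measurable ((fun x => b * x + c) @^-1` D).
Proof.
by move=> mD; rewrite -[X in measurable X]setTI; exact: measurable_affine.
Qed.

Lemma measurable_fun_affine (b c : R) D f : measurable D -> measurable_fun D f ->
  measurable_fun ((fun x => b * x + c) @^-1` D) (fun x => f (b * x + c)).
Proof.
move=> mD mf; apply: (@measurable_comp _ _ _ _ _ _ D) => //.
  by move=> _ [x Dx <-].
exact: (measurable_funTS (measurable_affine b c)).
Qed.

Lemma affine_integrable (b c : R) (b0 : 0 < b) D f : measurable D ->
  mu.-integrable D (EFin \o f) ->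
  mu.-integrable ((fun x => b * x + c) @^-1` D) (EFin \o (fun x => f (b * x + c))).
Proof.
move=> mD /integrableP[mf fi]; apply/integrableP; split.
  apply/measurable_EFinP; apply: measurable_fun_affine => //; exact/measurable_EFinP.
move: fi; rewrite (@affine_ge0_integral b c)//; last first.
  by apply: measurableT_comp.
move=> h; rewrite ltNge leye_eq; apply/negP => /eqP e; move: h.
by rewrite e mulry gtr0_sg// mul1e.
Qed.

(** The nonnegative case is applied to the positive and negative parts; integrability makes both
    integrals finite, so that [b] distributes over their difference. *)
Lemma affine_Rintegral (b c : R) (b0 : 0 < b) D f : measurable D ->
  mu.-integrable D (EFin \o f) ->
  Rintegral mu D f = b * Rintegral mu ((fun x => b * x + c) @^-1` D) (fun x => f (b * x + c)).
Proof.
move=> mD fi.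
have mf := measurable_int _ fi.
have fi' := affine_integrable c b0 mD fi.
have mD' := measurable_affine_preimage b c mD.
rewrite /Rintegral integralE [in RHS]integralE.
rewrite (@affine_ge0_integral b c b0 _ (EFin \o f)^\+%E)//; last exact: measurable_funepos.
rewrite (@affine_ge0_integral b c b0 _ (EFin \o f)^\-%E)//; last exact: measurable_funeneg.
have h1 := @integrable_pos_fin_num _ _ _ mu _ mD' _ fi'.
have h2 := @integrable_neg_fin_num _ _ _ mu _ mD' _ fi'.
move: h1 h2; set A := (X in X \is a fin_num); move=> h1.
set B := (X in X \is a fin_num); move=> h2.
rewrite [X in (b%:E * X - _)%E](_ : _ = A); last first.
  by apply: eq_integral => x _; rewrite !funeposE.
rewrite [X in (_ - b%:E * X)%E](_ : _ = B); last first.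
  by apply: eq_integral => x _; rewrite !funenegE.
change (fine (b%:E * A - b%:E * B)%E = b * fine (A - B)%E).
by rewrite -(fineK h1) -(fineK h2) -!EFinM -!EFinB /= mulrBr.
Qed.

End Integrals.

(** * Estimates for an H^1 function on a bounded interval *)

Section Sobolev.
Variable R : realType.
Local Notation mu := (@lebesgue_measure R).
Local Notation Int := (Rintegral mu).
Local Notation itg D f := (mu.-integrable D (EFin \o f)).
Implicit Types (f g : R -> R) (D : set R).

Lemma le_of_halving (X Y Z : R) : (forall k, X <= Y + Z / 2 ^+ k) -> X <= Y.
Proof.
move=> h; rewrite leNgt; apply/negP => YX.
have d0 : 0 < X - Y by rewrite subr_gt0.
pose k := Num.bound `|Z / (X - Y)|.
have hk : Z / (X - Y) < k%:R.
  by apply: le_lt_trans (ler_norm _) _; exact: archi_boundP.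
have k2 : k%:R <= 2 ^+ k :> R by rewrite -natrX ler_nat ltnW // ltn_expl.
have := h k; rewrite -lerBlDl leNgt ltr_pdivrMr ?exprn_gt0// mulrC -ltr_pdivrMr//.
by rewrite (lt_le_trans hk).
Qed.

Lemma mul2_le_young (r z k W : R) : 0 < k -> r ^+ 2 <= W ->
  2 * (r * z) <= W / k + k * z ^+ 2.
Proof.
move=> k0 rW; rewrite -subr_ge0.
have -> : W / k + k * z ^+ 2 - 2 * (r * z) = ((W - r ^+ 2) + (r - k * z) ^+ 2) / k.
  by field; rewrite gt_eqF.
apply: divr_ge0; last exact: ltW.
by rewrite addr_ge0 ?subr_ge0 ?sqr_ge0.
Qed.

Lemma integrable_le D f h : measurable D -> measurable_fun D f -> itg D h ->
  (forall x, D x -> `|f x| <= h x) -> itg D f.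
Proof.
move=> mD mf hi fh; apply: le_integrable hi => //; first exact/measurable_EFinP.
by move=> x Dx /=; rewrite lee_fin (le_trans (fh x Dx)) // ler_norm.
Qed.

Lemma integrable_itv_cst (a b k : R) : itg `[a, b] (fun=> k).
Proof.
apply: continuous_compact_integrable; first exact: segment_compact.
by apply: continuous_subspaceT => x; exact: cvg_cst.
Qed.

Lemma Rintegral_itv_cst (a b k : R) : a <= b -> Int `[a, b] (fun=> k) = k * (b - a).
Proof.
move=> ab; rewrite Rintegral_cst//; congr (_ * _).
have e : mu `[a, b] = (if (a%:E < b%:E)%E then b%:E - a%:E else 0)%E.
  exact: (lebesgue_measure_itv `[a, b]).
apply: (etrans (congr1 fine e)); rewrite lte_fin; case: ltP => //= ba.
by apply/eqP; rewrite eq_sym subr_eq0 eq_le ab ba.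
Qed.

Lemma integrable_addR D f g : measurable D -> itg D f -> itg D g ->
  itg D (fun x => f x + g x).
Proof.
move=> mD fi gi.
by rewrite (_ : EFin \o _ = (EFin \o f) \+ (EFin \o g))%E //; exact: integrableD.
Qed.

Lemma integrable_scaleR D f k : measurable D -> itg D f -> itg D (fun x => k * f x).
Proof.
move=> mD fi.
by rewrite (_ : EFin \o _ = fun x => k%:E * (EFin \o f) x)%E //; exact: integrableZl.
Qed.

(** The clause of [H1] for one edge, detached from the graph so that it also serves initial segments
    of the halfline and linear ramps. *)
Definition sobolev (l : R) f g :=
  measurable_fun `[0, l] g /\ itg `[0, l] (fun x => g x ^+ 2) /\
  (forall x, 0 <= x <= l -> f x = f 0 + Int `[0, x] g).

Section OneEdge.
Variables (l : R) (f g : R -> R).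
Hypothesis fg : sobolev l f g.

Lemma sub_itv_edge (a b : R) : 0 <= a -> b <= l -> `[a, b]%classic `<=` `[0, l]%classic.
Proof.
by move=> a0 bl x /=; rewrite !in_itv/= => /andP[ax xb]; rewrite (le_trans a0 ax) (le_trans xb bl).
Qed.

Lemma sobolev_deriv2_integrable (a b : R) : 0 <= a -> b <= l ->
  itg `[a, b] (fun x => g x ^+ 2).
Proof.
by move=> a0 bl; case: fg => _ [gi _]; apply: integrableS gi => //; exact: sub_itv_edge.
Qed.

Lemma sobolev_deriv_integrable (a b : R) : 0 <= a -> b <= l -> itg `[a, b] g.
Proof.
move=> a0 bl; case: (fg) => mg _.
apply: (@integrable_le _ _ (fun x => 1 + g x ^+ 2)) => //.
- by apply: measurable_funS mg => //; exact: sub_itv_edge.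
- apply: integrable_addR => //; first exact: integrable_itv_cst.
  exact: sobolev_deriv2_integrable.
- by move=> x _; rewrite ler_norml; apply/andP; split; nra.
Qed.

Lemma sobolev_diff (a b : R) : 0 <= a -> a <= b -> b <= l -> f b - f a = Int `[a, b] g.
Proof.
move=> a0 ab bl; case: (fg) => _ [_ fE].
rewrite (fE b) ?(le_trans a0 ab)// (fE a) ?a0 ?(le_trans ab)//.
rewrite (@Rintegral_cat _ g 0 a (BRight b))//; last exact: sobolev_deriv_integrable.
by ring.
Qed.

Lemma sobolev_deriv2_ge0 (a b : R) : 0 <= Int `[a, b] (fun x => g x ^+ 2).
Proof. by apply: Rintegral_ge0 => x _; exact: sqr_ge0. Qed.

Lemma sobolev_deriv2_cat (a b c : R) : 0 <= a -> a <= b -> b <= c -> c <= l ->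
  Int `[a, c] (fun x => g x ^+ 2) =
  Int `[a, b] (fun x => g x ^+ 2) + Int `[b, c] (fun x => g x ^+ 2).
Proof.
move=> a0 ab bc cl; apply: (@Rintegral_cat _ (fun x => g x ^+ 2) a b (BRight c)) => //.
exact: sobolev_deriv2_integrable.
Qed.

(** Cauchy-Schwarz, obtained by integrating [0 <= (c - g) ^+ 2] with [c] the mean slope. *)
Lemma sobolev_diff2_le (a b : R) : 0 <= a -> a <= b -> b <= l ->
  (f b - f a) ^+ 2 <= (b - a) * Int `[a, b] (fun x => g x ^+ 2).
Proof.
move=> a0; rewrite le_eqVlt => /predU1P[->|ab] bl.
  by rewrite !subrr mul0r expr2 mulr0.
have ab' := ltW ab; have h0 : 0 < b - a by rewrite subr_gt0.
set d := f b - f a; set T := Int _ _.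
pose c := d / (b - a).
have key : Int `[a, b] (fun x => (2 * c) * g x) <= Int `[a, b] (fun x => c ^+ 2 + g x ^+ 2).
  apply: le_Rintegral => //.
  - by apply: integrable_scaleR => //; exact: sobolev_deriv_integrable.
  - apply: integrable_addR => //; first exact: integrable_itv_cst.
    exact: sobolev_deriv2_integrable.
  - by move=> x _; have := sqr_ge0 (c - g x); nra.
move: key; rewrite RintegralZl//; last exact: sobolev_deriv_integrable.
rewrite RintegralD//; last 2 first.
- exact: integrable_itv_cst.
- exact: sobolev_deriv2_integrable.
rewrite Rintegral_itv_cst// -sobolev_diff// -/d -/T => key.
have dE : d = c * (b - a) by rewrite /c mulfVK// gt_eqF.
rewrite dE in key *; nra.
Qed.

(** A crude bound that depends on [l]; it serves only to dominate the powers of [f] in the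
    integrability lemmas. *)
Lemma sobolev_sup (x : R) : 0 <= x <= l ->
  f x ^+ 2 <= 2 * f 0 ^+ 2 + 2 * (l * Int `[0, l] (fun x => g x ^+ 2)).
Proof.
move=> /andP[x0 xl].
have h1 := sobolev_diff2_le (lexx 0) x0 xl.
have h2 := sobolev_deriv2_cat (lexx 0) x0 xl (lexx l).
have := sobolev_deriv2_ge0 0 x; have := sobolev_deriv2_ge0 x l.
move: h1 h2; rewrite subr0.
set T := Int `[0, l] _; set T1 := Int `[0, x] _; set T2 := Int `[x, l] _.
have := sqr_ge0 (f x - f 0 - f 0); nra.
Qed.

Lemma sobolev_measurable : measurable_fun `[0, l] f.
Proof.
have [l0|l0] := leP 0 l; last by rewrite set_itv_ge ?bnd_simp -?ltNge//; exact: measurable_fun_set0.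
have cf : {within `[0, l], continuous (fun x => Int `[0, x] g)}.
  exact: (parameterized_integral_continuous l0 (sobolev_deriv_integrable (lexx 0) (lexx l))).
have mI : measurable_fun `[0, l] (fun x => Int `[0, x] g).
  by apply: subspace_continuous_measurable_fun.
have : measurable_fun `[0, l] (fun x => f 0 + Int `[0, x] g).
  exact: measurable_funD.
apply: eq_measurable_fun => x; rewrite inE/= in_itv/= => xl.
by case: fg => _ [_ fE]; rewrite (fE x xl).
Qed.

Lemma sobolev_sq_integrable (a b : R) : 0 <= a -> b <= l -> itg `[a, b] (fun x => f x ^+ 2).
Proof.
move=> a0 bl; set C := 2 * f 0 ^+ 2 + 2 * (l * Int `[0, l] (fun x => g x ^+ 2)).
apply: (@integrable_le _ _ (fun=> C)) => //.
- apply: (@measurable_funS _ _ _ _ `[0, l]) => //; first exact: sub_itv_edge.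
  exact: (measurable_funX 2 sobolev_measurable).
- exact: integrable_itv_cst.
- move=> x /(sub_itv_edge a0 bl)/=; rewrite in_itv/= => xl.
  by rewrite ger0_norm ?sqr_ge0// sobolev_sup.
Qed.

Lemma sobolev_powR_integrable (p a b : R) : 0 <= p -> 0 <= a -> b <= l ->
  itg `[a, b] (fun x => powR `|f x| p).
Proof.
move=> p0 a0 bl; set C := 2 * f 0 ^+ 2 + 2 * (l * Int `[0, l] (fun x => g x ^+ 2)).
apply: (@integrable_le _ _ (fun=> powR (Num.sqrt C) p)) => //.
- apply: (@measurable_funS _ _ _ _ `[0, l]) => //; first exact: sub_itv_edge.
  apply: (measurableT_comp (measurable_powR _)).
  exact: (measurableT_comp (@normr_measurable _ setT) sobolev_measurable).
- exact: integrable_itv_cst.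
- move=> x /(sub_itv_edge a0 bl)/=; rewrite in_itv/= => xl.
  rewrite ger0_norm ?powR_ge0//; apply: ge0_ler_powR => //; rewrite ?nnegrE ?sqrtr_ge0//.
  by rewrite -sqrtr_sqr ler_wsqrtr// sobolev_sup.
Qed.

Lemma sobolev_sq_ge0 (a b : R) : 0 <= Int `[a, b] (fun x => f x ^+ 2).
Proof. by apply: Rintegral_ge0 => x _; exact: sqr_ge0. Qed.

(** A discrete form of [(f ^ 2)' = 2 f g] followed by Young: in [(f b - f a) * (f b + f a)] the
    second factor is replaced by [2 * f t], and the result is averaged over [t]. The oscillation of
    [f] causes the last term. *)
Lemma sobolev_young_short (lam a b : R) : 0 < lam -> 0 <= a -> a <= b -> b <= l ->
  `|f b ^+ 2 - f a ^+ 2| <= lam * Int `[a, b] (fun x => f x ^+ 2)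
    + Int `[a, b] (fun x => g x ^+ 2) / lam
    + 2 * (b - a) * Int `[a, b] (fun x => g x ^+ 2).
Proof.
move=> lam0 a0; rewrite le_eqVlt => /predU1P[->|ab] bl.
  rewrite !subrr normr0 mulr0 mul0r addr0 addr_ge0//.
  - by rewrite mulr_ge0 ?sobolev_sq_ge0// ltW.
  - by rewrite divr_ge0 ?sobolev_deriv2_ge0// ltW.
have ab' := ltW ab; have h0 : 0 < b - a by rewrite subr_gt0.
have dle := sobolev_diff2_le a0 ab' bl.
set T := Int `[a, b] (fun x => g x ^+ 2) in dle *; set M := Int `[a, b] (fun x => f x ^+ 2).
have T0 : 0 <= T := sobolev_deriv2_ge0 a b.
set h := b - a in h0 dle *.
pose W := h * T; pose r := `|f b - f a|.
have r0 : 0 <= r by rewrite normr_ge0.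
have rW : r ^+ 2 <= W by rewrite real_normK ?num_real.
have W0 : 0 <= W by rewrite mulr_ge0// ltW.
pose c := W / (lam * h) + 2 * W.
have pw t : `[a, b]%classic t -> `|f b ^+ 2 - f a ^+ 2| <= c + (lam * h) * f t ^+ 2.
  rewrite /= in_itv/= => /andP[at_ tb].
  have t0 := le_trans a0 at_; have tl := le_trans tb bl.
  have s1 := sobolev_diff2_le a0 at_ tl.
  have s2 := sobolev_diff2_le t0 tb bl.
  have TE := sobolev_deriv2_cat a0 at_ tb bl.
  have T1 := sobolev_deriv2_ge0 a t; have T2 := sobolev_deriv2_ge0 t b.
  rewrite -/T in TE.
  set Ta := Int `[a, t] _ in s1 TE T1; set Tb := Int `[t, b] _ in s2 TE T2.
  have s1W : `|f t - f a| ^+ 2 <= W.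
    rewrite real_normK ?num_real//; apply: le_trans s1 _.
    by apply: ler_pM; rewrite ?subr_ge0 ?TE//; rewrite /h; lra.
  have s2W : `|f b - f t| ^+ 2 <= W.
    rewrite real_normK ?num_real//; apply: le_trans s2 _.
    by apply: ler_pM; rewrite ?subr_ge0 ?TE//; rewrite /h; lra.
  have -> : f b ^+ 2 - f a ^+ 2 = (f b - f a) * (f b + f a) by ring.
  rewrite normrM -/r.
  have sumle : `|f b + f a| <= 2 * `|f t| + `|f t - f a| + `|f b - f t|.
    have -> : f b + f a = (2 * f t - (f t - f a)) + (f b - f t) by ring.
    apply: le_trans (ler_normD _ _) _; rewrite lerD2r.
    by apply: le_trans (ler_normB _ _) _; rewrite normrM ger0_norm.
  apply: le_trans (ler_wpM2l r0 sumle) _.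
  move: s1W s2W; have := normr_ge0 (f t - f a); have := normr_ge0 (f b - f t).
  set s1' := `|f t - f a|; set s2' := `|f b - f t| => s20 s10 s1W s2W.
  have e1 : r * s1' <= W by have := sqr_ge0 (r - s1'); nra.
  have e2 : r * s2' <= W by have := sqr_ge0 (r - s2'); nra.
  have lh : 0 < lam * h by rewrite mulr_gt0.
  have e3 : 2 * (r * `|f t|) <= W / (lam * h) + (lam * h) * f t ^+ 2.
    have -> : f t ^+ 2 = `|f t| ^+ 2 by rewrite real_normK ?num_real.
    exact: mul2_le_young.
  rewrite /c; nra.
have key : Int `[a, b] (fun=> `|f b ^+ 2 - f a ^+ 2|) <= Int `[a, b] (fun t => c + (lam * h) * f t ^+ 2).
  apply: le_Rintegral => //.
  - exact: integrable_itv_cst.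
  - apply: integrable_addR => //; first exact: integrable_itv_cst.
    by apply: integrable_scaleR => //; exact: sobolev_sq_integrable.
move: key; rewrite RintegralD//; last 2 first.
- exact: integrable_itv_cst.
- by apply: integrable_scaleR => //; exact: sobolev_sq_integrable.
rewrite RintegralZl//; last exact: sobolev_sq_integrable.
rewrite !Rintegral_itv_cst// -/h -/M => key.
rewrite -(ler_pM2r h0); apply: le_trans key _; rewrite le_eqVlt; apply/orP; left; apply/eqP.
by rewrite /c /W; field; rewrite !gt_eqF.
Qed.

(* The defect in [sobolev_young_short] is [b - a] times an additive quantity, so
   bisecting the interval makes it vanish. *)
Lemma sobolev_young (lam a b : R) : 0 < lam -> 0 <= a -> a <= b -> b <= l ->
  `|f b ^+ 2 - f a ^+ 2| <= lam * Int `[a, b] (fun x => f x ^+ 2)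
    + Int `[a, b] (fun x => g x ^+ 2) / lam.
Proof.
move=> lam0 a0 ab bl.
apply: (@le_of_halving _ _ (2 * (b - a) * Int `[a, b] (fun x => g x ^+ 2))) => k.
elim: k a b a0 ab bl => [|k IH] a b a0 ab bl.
  by rewrite expr0 divr1; exact: sobolev_young_short.
pose c := (a + b) / 2.
have ac : a <= c by rewrite /c; lra.
have cb : c <= b by rewrite /c; lra.
have c0 := le_trans a0 ac; have cl := le_trans cb bl.
have := IH a c a0 ac cl; have := IH c b c0 cb bl.
rewrite (sobolev_deriv2_cat a0 ac cb bl).
rewrite (@Rintegral_cat _ (fun x => f x ^+ 2) a c (BRight b))//; last first.
  exact: sobolev_sq_integrable.
have -> : c - a = (b - a) / 2 by rewrite /c; field.
have -> : b - c = (b - a) / 2 by rewrite /c; field.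
set T1 := Int `[a, c] (fun x => g x ^+ 2); set T2 := Int `[c, b] (fun x => g x ^+ 2).
set M1 := Int `[a, c] _; set M2 := Int `[c, b] _.
have tri : `|f b ^+ 2 - f a ^+ 2| <= `|f b ^+ 2 - f c ^+ 2| + `|f c ^+ 2 - f a ^+ 2|.
  by apply: le_trans (ler_normD _ _); rewrite addrA subrK.
move=> h1 h2; apply: le_trans tri _; apply: le_trans (lerD h1 h2) _.
rewrite le_eqVlt; apply/orP; left; apply/eqP.
rewrite exprS; have k0 : 0 < 2 ^+ k :> R by rewrite exprn_gt0.
by field; rewrite !gt_eqF.
Qed.

(** The slack [eta] makes the contradiction strict after integration, so no minimum has to be
    attained. *)
Lemma sobolev_average (eta : R) : 0 < l -> 0 < eta ->
  exists2 y, 0 <= y <= l & l * f y ^+ 2 <= Int `[0, l] (fun x => f x ^+ 2) + eta.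
Proof.
move=> l0 eta0; apply: contrapT => hn.
set M := Int _ _ in hn.
have hlt y : 0 <= y <= l -> (M + eta) / l <= f y ^+ 2.
  move=> yl; rewrite ler_pdivrMr// mulrC leNgt; apply/negP => hy.
  by apply: hn; exists y => //; exact: ltW.
have : Int `[0, l] (fun=> (M + eta) / l) <= M.
  apply: le_Rintegral => //; first exact: integrable_itv_cst.
  exact: sobolev_sq_integrable.
rewrite Rintegral_itv_cst ?(ltW l0)// subr0 mulfVK ?gt_eqF//.
by rewrite leNgt ltrDl eta0.
Qed.

End OneEdge.
End Sobolev.

(** * The halfline: concatenation and affine changes of variable *)

Section Halfline.
Variable R : realType.
Local Notation mu := (@lebesgue_measure R).
Local Notation Int := (Rintegral mu).
Local Notation itg D f := (mu.-integrable D (EFin \o f)).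
Local Notation hl := [set` `[0 : R, +oo[%R].
Implicit Types (f g a b : R -> R) (D : set R).

Lemma integrableU D1 D2 f : measurable D1 -> measurable D2 -> [disjoint D1 & D2] ->
  itg D1 f -> itg D2 f -> itg (D1 `|` D2) f.
Proof.
move=> m1 m2 d12 /integrableP[mf1 i1] /integrableP[mf2 i2].
have mU : measurable_fun (D1 `|` D2) (EFin \o f).
  apply/measurable_EFinP/measurable_funU => //.
  by split; apply/measurable_EFinP.
apply/integrableP; split => //.
rewrite ge0_integral_setU//; last by apply: measurableT_comp.
by rewrite lte_add_pinfty.
Qed.

(** The shift is spelled [1 * x + - l] so that it is literally an instance of the affine maps
    [b * x + c] treated above. *)
Definition concatf (l : R) a b (x : R) := if x <= l then a x else b (1 * x + - l).

Lemma hl_split (l : R) : 0 <= l -> hl = `[0, l] `|` `]l, +oo[.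
Proof.
move=> l0; apply/seteqP; split => x /=; rewrite !in_itv/= !andbT.
  by move=> x0; have [xl|xl] := leP x l; [left; rewrite x0|right].
by move=> [/andP[]//|/ltW]; exact: le_trans.
Qed.

Lemma split_disjoint (l : R) : [disjoint `[0, l]%classic & `]l, +oo[%classic].
Proof.
apply/disj_setPS => x [] /=; rewrite !in_itv/= andbT => /andP[_ xl] lx.
by move: (le_lt_trans xl lx); rewrite ltxx.
Qed.

Lemma shift_preimage (l : R) : (fun x : R => 1 * x + - l) @^-1` `]0, +oo[ = `]l, +oo[%classic.
Proof.
by apply/seteqP; split => x /=; rewrite !in_itv/= !andbT mul1r subr_gt0.
Qed.

Lemma concatf_left_eq (l : R) a b : {in `[0, l]%classic, concatf l a b =1 a}.
Proof. by move=> x; rewrite inE/= in_itv/= /concatf => /andP[_ ->]. Qed.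

Lemma concatf_right_eq (l : R) a b :
  {in `]l, +oo[%classic, concatf l a b =1 (fun x => b (1 * x + - l))}.
Proof. by move=> x; rewrite inE/= in_itv/= andbT /concatf leNgt => ->. Qed.

Lemma concatf_measurable (l : R) a b : 0 <= l -> measurable_fun `[0, l] a ->
  measurable_fun hl b -> measurable_fun hl (concatf l a b).
Proof.
move=> l0 ma mb; rewrite (hl_split l0); apply/measurable_funU => //; split.
  apply: eq_measurable_fun ma => x xl; exact/esym/concatf_left_eq.
have : measurable_fun `]l, +oo[ (fun x => b (1 * x + - l)).
  rewrite -(shift_preimage l); apply: measurable_fun_affine => //.
  by apply: measurable_funS mb => // x /=; rewrite !in_itv/= !andbT; exact: ltW.
apply: eq_measurable_fun => x xl; exact/esym/concatf_right_eq.
Qed.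

Lemma concatf_integral (l : R) a b : 0 <= l -> itg `[0, l] a -> itg hl b ->
  itg hl (concatf l a b) /\ Int hl (concatf l a b) = Int `[0, l] a + Int hl b.
Proof.
move=> l0 ai bi.
have ai' : itg `[0, l] (concatf l a b).
  by apply: eq_integrable ai => // x xl /=; rewrite concatf_left_eq.
have bi0 : itg `]0, +oo[ b.
  by apply: integrableS bi => // x /=; rewrite !in_itv/= !andbT; exact: ltW.
have bi1 : itg `]l, +oo[ (fun x => b (1 * x + - l)).
  by rewrite -(shift_preimage l); exact: affine_integrable.
have bi' : itg `]l, +oo[ (concatf l a b).
  by apply: eq_integrable bi1 => // x xl /=; rewrite concatf_right_eq.
have gi : itg hl (concatf l a b).
  by rewrite (hl_split l0); apply: integrableU => //; exact: split_disjoint.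
split => //.
rewrite (hl_split l0) Rintegral_setU//; last 2 first.
- by rewrite -hl_split.
- exact: split_disjoint.
congr (_ + _); first by apply: eq_Rintegral; exact: concatf_left_eq.
(* The junction point belongs to the left piece, so the right piece lives on an open interval;
   opening [hl] at its endpoint does not change the integral. *)
rewrite -(hl_split l0) -(Rintegral_itv_obnd_cbnd bi0).
rewrite (@affine_Rintegral _ 1 (- l) ltr01 _ b)// mul1r (shift_preimage l).
by apply: eq_Rintegral; exact: concatf_right_eq.
Qed.

Lemma concatf_integral_right (l : R) a b (x : R) : 0 <= l -> l <= x -> itg `[0, x - l] b ->
  Int `[l, x] (concatf l a b) = Int `[0, x - l] b.
Proof.
move=> l0 lx bi.
have bi0 : itg `]0, x - l] b.
  by apply: integrableS bi => // y /=; rewrite !in_itv/= => /andP[/ltW -> ->].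
have pre : (fun y : R => 1 * y + - l) @^-1` `]0, x - l] = `]l, x]%classic.
  by apply/seteqP; split => y /=; rewrite !in_itv/= !mul1r subr_gt0 lerD2r.
have bi1 : itg `]l, x] (fun y => b (1 * y + - l)).
  by rewrite -pre; exact: affine_integrable.
have eqr : {in `]l, x]%classic, concatf l a b =1 (fun y => b (1 * y + - l))}.
  by move=> y; rewrite inE/= in_itv/= => /andP[ly _]; rewrite /concatf leNgt ly.
have bi' : itg `]l, x] (concatf l a b).
  by apply: eq_integrable bi1 => // y yl /=; rewrite eqr.
rewrite -(Rintegral_itv_obnd_cbnd bi') -(Rintegral_itv_obnd_cbnd bi0).
rewrite (@affine_Rintegral _ 1 (- l) ltr01 _ b)// mul1r pre.
exact: eq_Rintegral.
Qed.

Definition hsobolev f g :=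
  measurable_fun hl g /\ itg hl (fun x => g x ^+ 2) /\
  measurable_fun hl f /\ itg hl (fun x => f x ^+ 2) /\
  (forall x, 0 <= x -> f x = f 0 + Int `[0, x] g).

Lemma sub_hl (c d : R) : 0 <= c -> `[c, d]%classic `<=` hl.
Proof. by move=> c0 x /=; rewrite !in_itv/= andbT => /andP[cx _]; exact: le_trans cx. Qed.

Lemma sub_hly (c : R) : 0 <= c -> `[c, +oo[%classic `<=` hl.
Proof. by move=> c0 x /=; rewrite !in_itv/= !andbT; exact: le_trans. Qed.

Lemma hsobolev_sobolev f g (l : R) : hsobolev f g -> sobolev l f g.
Proof.
move=> [mg [gi [mf [fi fE]]]]; split; last split.
- by apply: measurable_funS mg => //; exact: sub_hl.
- by apply: integrableS gi => //; exact: sub_hl.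
- by move=> x /andP[x0 _]; exact: fE.
Qed.

Section Affine.
Variables (f g : R -> R) (al b c : R).
Hypotheses (fg : hsobolev f g) (b0 : 0 < b) (c0 : 0 <= c).
(** One family for two uses: rescaling ([c = 0]) and passing to the tail beyond [c]
    ([al = b = 1]). *)
Let w x := al * f (b * x + c).
Let dw x := al * b * g (b * x + c).

Let pre : (fun x : R => b * x + c) @^-1` `[c, +oo[ = hl.
Proof.
by apply/seteqP; split => x /=; rewrite !in_itv/= !andbT lerDr pmulr_rge0.
Qed.

Let pre_cc (x : R) : (fun x : R => b * x + c) @^-1` `[c, b * x + c] = `[0, x]%classic.
Proof.
apply/seteqP; split => y /=; rewrite !in_itv/= lerD2r ler_pM2l//;
by rewrite lerDr pmulr_rge0.
Qed.

Lemma affine_mass : Int hl (fun x => w x ^+ 2) = al ^+ 2 / b * Int `[c, +oo[ (fun x => f x ^+ 2).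
Proof.
have [_ [_ [_ [fi _]]]] := fg.
have fi' : itg `[c, +oo[ (fun x => f x ^+ 2) by apply: integrableS fi => //; exact: sub_hly.
have := affine_integrable c b0 _ fi'; rewrite pre => /(_ (measurable_itv _)) wi.
rewrite (@affine_Rintegral _ b c b0 _ _ _ fi')// pre.
transitivity (Int hl (fun x => al ^+ 2 * f (b * x + c) ^+ 2)).
  by apply: eq_Rintegral => x _; rewrite /w exprMn.
by rewrite RintegralZl// mulrA mulfVK// gt_eqF.
Qed.

Lemma affine_kinetic : Int hl (fun x => dw x ^+ 2) = al ^+ 2 * b * Int `[c, +oo[ (fun x => g x ^+ 2).
Proof.
have [_ [fi _]] := fg.
have fi' : itg `[c, +oo[ (fun x => g x ^+ 2) by apply: integrableS fi => //; exact: sub_hly.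
have := affine_integrable c b0 _ fi'; rewrite pre => /(_ (measurable_itv _)) wi.
rewrite (@affine_Rintegral _ b c b0 _ _ _ fi')// pre.
transitivity (Int hl (fun x => (al * b) ^+ 2 * g (b * x + c) ^+ 2)).
  by apply: eq_Rintegral => x _; rewrite /dw exprMn.
by rewrite RintegralZl//; ring.
Qed.

Lemma affine_potential (p : R) : itg hl (fun x => powR `|f x| p) ->
  Int hl (fun x => powR `|w x| p) = powR `|al| p / b * Int `[c, +oo[ (fun x => powR `|f x| p).
Proof.
move=> fi.
have fi' : itg `[c, +oo[ (fun x => powR `|f x| p) by apply: integrableS fi => //; exact: sub_hly.
have := affine_integrable c b0 _ fi'; rewrite pre => /(_ (measurable_itv _)) wi.
rewrite (@affine_Rintegral _ b c b0 _ _ _ fi')// pre.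
transitivity (Int hl (fun x => powR `|al| p * powR `|f (b * x + c)| p)).
  by apply: eq_Rintegral => x _; rewrite /w normrM powRM.
by rewrite RintegralZl// mulrA mulfVK// gt_eqF.
Qed.

Lemma affine_hsobolev : hsobolev w dw.
Proof.
have [mg [gi [mf [fi fE]]]] := fg.
have sub : `[c, +oo[%classic `<=` hl by exact: sub_hly.
split; [|split; [|split; [|split]]].
- apply: measurable_funM => //; rewrite -pre; apply: measurable_fun_affine => //.
  exact: measurable_funS mg.
- have fi' : itg `[c, +oo[ (fun x => g x ^+ 2) by apply: integrableS gi.
  have := affine_integrable c b0 _ fi'; rewrite pre => /(_ (measurable_itv _)) wi.
  rewrite (_ : (fun x => dw x ^+ 2) = fun x => (al * b) ^+ 2 * g (b * x + c) ^+ 2).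
    exact: integrable_scaleR.
  by apply/funext => x; rewrite /dw exprMn.
- apply: measurable_funM => //; rewrite -pre; apply: measurable_fun_affine => //.
  exact: measurable_funS mf.
- have fi' : itg `[c, +oo[ (fun x => f x ^+ 2) by apply: integrableS fi.
  have := affine_integrable c b0 _ fi'; rewrite pre => /(_ (measurable_itv _)) wi.
  rewrite (_ : (fun x => w x ^+ 2) = fun x => al ^+ 2 * f (b * x + c) ^+ 2).
    exact: integrable_scaleR.
  by apply/funext => x; rewrite /w exprMn.
- move=> x x0; have cx : c <= b * x + c by rewrite lerDr mulr_ge0// ltW.
  have S := hsobolev_sobolev (b * x + c) fg.
  have gi' := sobolev_deriv_integrable S c0 (lexx _).
  have := sobolev_diff S c0 cx (lexx _).
  rewrite (@affine_Rintegral _ b c b0 _ _ _ gi')// pre_cc => e.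
  have wi := affine_integrable c b0 _ gi'; rewrite pre_cc in wi.
  rewrite /w /dw RintegralZl//; last exact: wi (measurable_itv _).
by rewrite mulr0 add0r -mulrA -e; ring.
Qed.

End Affine.
End Halfline.

(** * Mass, kinetic energy and potential on the halfline; ramps *)

Section HalflineFunctionals.
Variable R : realType.
Local Notation mu := (@lebesgue_measure R).
Local Notation Int := (Rintegral mu).
Local Notation itg D f := (mu.-integrable D (EFin \o f)).
Local Notation hl := [set` `[0 : R, +oo[%R].
Implicit Types (p : R) (f g : R -> R) (D : set R).

Definition hmass f := Int hl (fun x => f x ^+ 2).
Definition hkin g := Int hl (fun x => g x ^+ 2).
Definition hpot (p : R) f := Int hl (fun x => powR `|f x| p).
Definition henergy (p : R) f g := 2^-1 * hkin g - p^-1 * hpot p f.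

Lemma Rintegral_subset D1 D2 (h : R -> R) : measurable D1 -> measurable D2 -> D1 `<=` D2 ->
  (forall x, D2 x -> 0 <= h x) -> itg D2 h -> Int D1 h <= Int D2 h.
Proof.
move=> m1 m2 s12 h0 hi.
have hi1 : itg D1 h by apply: integrableS hi.
rewrite /Rintegral; apply: fine_le.
- exact: (@integrable_fin_num _ _ _ mu _ m1 _ hi1).
- exact: (@integrable_fin_num _ _ _ mu _ m2 _ hi).
- apply: ge0_subset_integral => //; first exact: (measurable_int mu hi).
Qed.

Lemma hmass_ge0 f : 0 <= hmass f.
Proof. by apply: Rintegral_ge0 => x _; exact: sqr_ge0. Qed.

Lemma hkin_ge0 g : 0 <= hkin g.
Proof. by apply: Rintegral_ge0 => x _; exact: sqr_ge0. Qed.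

Lemma hpot_ge0 p f : 0 <= hpot p f.
Proof. by apply: Rintegral_ge0 => x _; exact: powR_ge0. Qed.

(** On [[0, 2 ^ k]] some point has [f y ^ 2] of size [1 / 2 ^ k], because the mass is finite;
    [sobolev_young] links it to the origin, and [k] tends to infinity. *)
Lemma hsobolev_origin f g (lam : R) : hsobolev f g -> 0 < lam ->
  f 0 ^+ 2 <= lam * hmass f + hkin g / lam.
Proof.
move=> fg lam0; have [_ [gi [_ [fi _]]]] := fg.
apply: (@le_of_halving _ _ _ (hmass f + 1)) => k.
have k0 : 0 < 2 ^+ k :> R by rewrite exprn_gt0.
have S := hsobolev_sobolev (2 ^+ k) fg.
have [y /andP[y0 yl] hy] := sobolev_average S k0 ltr01.
have hM d : Int `[0, d] (fun x => f x ^+ 2) <= hmass f.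
  by apply: Rintegral_subset => //; [exact: sub_hl | move=> *; exact: sqr_ge0].
have hT : Int `[0, y] (fun x => g x ^+ 2) <= hkin g.
  by apply: Rintegral_subset => //; [exact: sub_hl | move=> *; exact: sqr_ge0].
have := sobolev_young S lam0 (lexx 0) y0 yl.
rewrite ler_norml => /andP[h _].
have h1 : f y ^+ 2 <= (hmass f + 1) / 2 ^+ k.
  by rewrite ler_pdivlMr// mulrC (le_trans hy)// lerD2r.
have h2 : lam * Int `[0, y] (fun x => f x ^+ 2) <= lam * hmass f.
  by rewrite ler_pM2l.
have h3 : Int `[0, y] (fun x => g x ^+ 2) / lam <= hkin g / lam.
  by rewrite ler_pM2r ?invr_gt0.
lra.
Qed.

Lemma hmass_tail_le f g (c : R) : hsobolev f g -> 0 <= c ->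
  Int `[c, +oo[ (fun x => f x ^+ 2) <= hmass f.
Proof.
move=> [_ [_ [_ [fi _]]]] c0; apply: Rintegral_subset => //; first exact: sub_hly.
by move=> *; exact: sqr_ge0.
Qed.

Lemma hkin_tail_le f g (c : R) : hsobolev f g -> 0 <= c ->
  Int `[c, +oo[ (fun x => g x ^+ 2) <= hkin g.
Proof.
move=> [_ [gi _]] c0; apply: Rintegral_subset => //; first exact: sub_hly.
by move=> *; exact: sqr_ge0.
Qed.

(** The bound at the origin is applied to the tail starting at [x]. *)
Lemma hsobolev_sup f g (lam x : R) : hsobolev f g -> 0 < lam -> 0 <= x ->
  f x ^+ 2 <= lam * hmass f + hkin g / lam.
Proof.
move=> fg lam0 x0.
have h := hsobolev_origin (affine_hsobolev 1 fg ltr01 x0) lam0.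
rewrite /hmass /hkin (affine_mass 1 fg ltr01 x0) (affine_kinetic 1 fg ltr01 x0) in h.
rewrite expr1n invr1 !mul1r add0r in h.
apply: le_trans h _; apply: lerD.
  by rewrite ler_pM2l//; exact: hmass_tail_le fg x0.
by rewrite ler_pM2r ?invr_gt0//; exact: hkin_tail_le fg x0.
Qed.

(** Only the factor [|z| ^ (p - 2)] is estimated by the supremum; keeping [z ^ 2] is what makes
    potentials proportional to masses. *)
Lemma powR_norm_le (p z B : R) : 2 < p -> z ^+ 2 <= B ->
  powR `|z| p <= powR B ((p - 2) / 2) * z ^+ 2.
Proof.
move=> p2 zB; have B0 := le_trans (sqr_ge0 z) zB.
have -> : p = (p - 2) + 2 by ring.
rewrite powRD; last by apply/implyP; rewrite subrK gt_eqF// (lt_trans _ p2).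
rewrite addrK powR_mulrn// real_normK ?num_real//.
rewrite ler_wpM2r ?sqr_ge0//.
have q0 : 0 <= (p - 2) / 2 by rewrite divr_ge0// subr_ge0 ltW.
have -> : powR `|z| (p - 2) = powR (z ^+ 2) ((p - 2) / 2).
  rewrite -(@real_normK _ z) ?num_real// -powR_mulrn// -powRrM.
  by congr (powR _ _); field.
by apply: ge0_ler_powR => //; rewrite nnegrE// sqr_ge0.
Qed.

Lemma hpot_integrable p f g : 2 < p -> hsobolev f g -> itg hl (fun x => powR `|f x| p).
Proof.
move=> p2 fg; have [_ [_ [mf [fi _]]]] := fg.
pose B := 1 * hmass f + hkin g / 1.
apply: (@integrable_le _ _ _ (fun x => powR B ((p - 2) / 2) * f x ^+ 2)) => //.
- apply: (measurableT_comp (measurable_powR _)).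
  exact: (measurableT_comp (@normr_measurable _ setT) mf).
- exact: integrable_scaleR.
- move=> x; rewrite /= in_itv/= andbT => x0.
  rewrite ger0_norm ?powR_ge0//; apply: powR_norm_le => //.
  exact: hsobolev_sup fg ltr01 x0.
Qed.

Lemma hpot_le p f g (B : R) : 2 < p -> hsobolev f g ->
  (forall x, 0 <= x -> f x ^+ 2 <= B) -> hpot p f <= powR B ((p - 2) / 2) * hmass f.
Proof.
move=> p2 fg fB; have [_ [_ [mf [fi _]]]] := fg.
rewrite -RintegralZl//; apply: le_Rintegral => //.
- exact: hpot_integrable fg.
- exact: integrable_scaleR.
- by move=> x; rewrite /= in_itv/= andbT => x0; apply: powR_norm_le => //; exact: fB.
Qed.

Lemma sqr_convex_le (t a b : R) : 0 <= t -> t <= 1 ->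
  ((1 - t) * a + t * b) ^+ 2 <= a ^+ 2 + b ^+ 2.
Proof.
move=> t0 t1; have t1' : 0 <= 1 - t by rewrite subr_ge0.
have h1 := mulr_ge0 (mulr_ge0 t0 t1') (sqr_ge0 (a - b)).
have h2 := mulr_ge0 t0 (sqr_ge0 a); have h3 := mulr_ge0 t1' (sqr_ge0 b).
nra.
Qed.

Lemma linear_sobolev (a k l : R) : sobolev l (fun x => a + k * x) (fun=> k).
Proof.
split; last split.
- exact: measurable_cst.
- exact: integrable_itv_cst.
- by move=> x /andP[x0 _]; rewrite Rintegral_itv_cst// mulr0 addr0 subr0.
Qed.

Lemma prepend_line p f g (a l : R) : 2 < p -> hsobolev f g -> 0 < l ->
  exists w dw, [/\ hsobolev w dw, w 0 = a,
    hmass f <= hmass w <= hmass f + (a ^+ 2 + f 0 ^+ 2) * l,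
    hkin dw = hkin g + (f 0 - a) ^+ 2 / l & hpot p f <= hpot p w].
Proof.
move=> p2 fg l0; have l0' := ltW l0; have [mg [gi [mf [fi fE]]]] := fg.
have p0 : 0 <= p by rewrite (le_trans _ (ltW p2)).
pose k := (f 0 - a) / l.
have kl : k * l = f 0 - a by rewrite /k mulfVK// gt_eqF.
pose L x := a + k * x.
have SL := linear_sobolev a k l; rewrite -/L in SL.
pose w := concatf l L f; pose dw := concatf l (fun=> k) g.
have comp (h : R -> R) u v : (fun x => h (concatf l u v x)) = concatf l (fun x => h (u x)) (fun x => h (v x)).
  by apply/funext => x; rewrite /concatf; case: ifP.
have w2 : (fun x => w x ^+ 2) = concatf l (fun x => L x ^+ 2) (fun x => f x ^+ 2).
  exact: (comp (fun z => z ^+ 2)).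
have dw2 : (fun x => dw x ^+ 2) = concatf l (fun=> k ^+ 2) (fun x => g x ^+ 2).
  exact: (comp (fun z => z ^+ 2)).
have wp : (fun x => powR `|w x| p) = concatf l (fun x => powR `|L x| p) (fun x => powR `|f x| p).
  exact: (comp (fun z => powR `|z| p)).
have L2i : itg `[0, l] (fun x => L x ^+ 2) by exact: (sobolev_sq_integrable SL (lexx 0) (lexx l)).
have [w2i w2E] := concatf_integral l0' L2i fi.
have [dw2i dw2E] := concatf_integral l0' (integrable_itv_cst 0 l (k ^+ 2)) gi.
have [wpi wpE] := concatf_integral l0' (sobolev_powR_integrable SL p0 (lexx 0) (lexx l)) (hpot_integrable p2 fg).
have w0 : w 0 = a by rewrite /w /concatf l0' /L mulr0 addr0.
exists w, dw; split => //.
- split; [|split; [|split; [|split]]].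
  + by apply: concatf_measurable => //; exact: measurable_cst.
  + by rewrite dw2.
  + by apply: concatf_measurable => //; exact: sobolev_measurable SL.
  + by rewrite w2.
  + move=> x x0; rewrite w0; have [xl|lx] := leP x l.
      rewrite /w /concatf xl /L; congr (_ + _).
      rewrite -[X in k * X]subr0 -Rintegral_itv_cst//.
      apply: eq_Rintegral => y; rewrite inE/= in_itv/= => /andP[_ yx].
      by rewrite /dw /concatf (le_trans yx xl).
    have S := hsobolev_sobolev (x - l) fg.
    have gix := sobolev_deriv_integrable S (lexx 0) (lexx _).
    have dwi : itg `[0, x] dw.
      apply: (@integrable_le _ _ _ (fun y => 1 + dw y ^+ 2)) => //.
      - apply: (@measurable_funS _ _ _ _ hl) => //; first exact: sub_hl.
        by apply: concatf_measurable => //; exact: measurable_cst.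
      - apply: integrable_addR => //; first exact: integrable_itv_cst.
        by rewrite dw2; apply: integrableS dw2i => //; exact: sub_hl.
      - by move=> y _; rewrite ler_norml; apply/andP; split; nra.
    rewrite (@Rintegral_cat _ dw 0 l (BRight x))//; last exact: ltW.
    rewrite /dw concatf_integral_right//; last exact: ltW.
    have -> : Int `[0, l] (concatf l (fun=> k) g) = k * l.
      rewrite -[X in k * X]subr0 -Rintegral_itv_cst//.
      apply: eq_Rintegral; exact: concatf_left_eq.
    rewrite kl /w /concatf leNgt lx /= mul1r (fE (x - l)) ?subr_ge0 ?(ltW lx)//.
    by ring.
- rewrite /hmass w2 w2E.
  have h1 : 0 <= Int `[0, l] (fun x => L x ^+ 2) by apply: Rintegral_ge0 => y _; exact: sqr_ge0.
  have h2 : Int `[0, l] (fun x => L x ^+ 2) <= Int `[0, l] (fun=> a ^+ 2 + f 0 ^+ 2).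
    apply: le_Rintegral => //; first exact: integrable_itv_cst.
    move=> y; rewrite /= in_itv/= => /andP[y0 yl].
    pose t := y / l; have t0 : 0 <= t by rewrite divr_ge0.
    have t1 : t <= 1 by rewrite ler_pdivrMr// mul1r.
    have -> : L y = (1 - t) * a + t * f 0.
      by rewrite /L /k /t; field; rewrite gt_eqF.
    exact: sqr_convex_le.
  rewrite Rintegral_itv_cst// subr0 in h2.
  by rewrite lerDr h1 addrC lerD2l h2.
- rewrite /hkin dw2 dw2E Rintegral_itv_cst// subr0 addrC; congr (_ + _).
  by rewrite /k; field; rewrite gt_eqF.
- rewrite /hpot wp wpE lerDr; apply: Rintegral_ge0 => y _; exact: powR_ge0.
Qed.

End HalflineFunctionals.

(** * Two inequalities for real powers *)

Section Powers.
Variable R : realType.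

Lemma gt0_powRD (x r s : R) : 0 < x -> powR x (r + s) = powR x r * powR x s.
Proof. by move=> x0; rewrite powRD// (gt_eqF x0) implybT. Qed.

(** Taking [t] to be the square root of [tau] gives [tau <= (1 + 8 * sqrt tau) ^ q], whose
    right-hand side grows like [tau ^ (q / 2)], slower than [tau]. *)
Lemma sublinear_fixpoint_bound (q : R) : 0 <= q < 2 ->
  exists2 C, 1 <= C & forall tau : R, 0 <= tau ->
    (forall t, 0 < t -> tau <= powR (1 + 4 * (t + tau / t)) q) -> tau <= C.
Proof.
move=> /andP[q0 q2].
have q2' : 0 < 2 - q by rewrite subr_gt0.
(* For [tau >= 1] and [s] its square root, [1 + 8 * s <= 9 * s], so [s ^ (2 - q) <= 9 ^ q]. *)
exists (powR 9 (q * (2 / (2 - q)))).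
  rewrite -[X in X <= _](powRr0 9); apply: ler_powR; first by rewrite ler1n.
  by rewrite mulr_ge0// divr_ge0// ltW.
move=> tau tau0 h; have [t1|t1] := ltP tau 1.
  apply: (le_trans (ltW t1)); rewrite -[X in X <= _](powRr0 9); apply: ler_powR.
    by rewrite ler1n.
  by rewrite mulr_ge0// divr_ge0// ltW.
have tp : 0 < tau by rewrite (lt_le_trans _ t1).
pose s := Num.sqrt tau; have s0 : 0 < s by rewrite sqrtr_gt0.
have ss : s ^+ 2 = tau by rewrite sqr_sqrtr.
have s1 : 1 <= s by rewrite -(ler_sqr _ (ltW s0)) ?expr1n ?ss// nnegrE.
have h1 : tau <= powR 9 q * powR s q.
  rewrite -powRM ?(ltW s0)//; apply: le_trans (h s s0) _.
  apply: ge0_ler_powR => //; rewrite ?nnegrE.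
  - by rewrite addr_ge0// mulr_ge0// addr_ge0 ?divr_ge0 ?(ltW s0).
  - by rewrite mulr_ge0 ?(ltW s0).
  - have -> : tau / s = s by rewrite -ss expr2 mulfK// gt_eqF.
    lra.
have tE : tau = powR s 2 by rewrite powR_mulrn ?ss// ltW.
have h2 : powR s (2 - q) <= powR 9 q.
  rewrite -(ler_pM2r (powR_gt0 q s0)) -gt0_powRD//.
  by rewrite subrK -tE.
rewrite powRrM.
have -> : tau = powR (powR s (2 - q)) (2 / (2 - q)).
  by rewrite -powRrM tE; congr (powR _ _); field; rewrite gt_eqF.
by apply: ge0_ler_powR => //; rewrite ?nnegrE ?powR_ge0// divr_ge0// ltW.
Qed.

(** The right-hand side is the chord of the convex function [z ^ n] over [[1, 2]]. *)
Lemma expr_le_linear (z : R) n : 1 <= z <= 2 -> z ^+ n <= 1 + (2 ^+ n - 1) * (z - 1).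
Proof.
move=> /andP[z1 z2]; elim: n => [|n IH]; first by rewrite !expr0 subrr mul0r addr0.
rewrite !exprS; have z0 : 0 <= z by rewrite (le_trans _ z1).
apply: le_trans (ler_wpM2l z0 IH) _.
have : 1 <= 2 ^+ n :> R by rewrite exprn_ege1// ler1n.
set c := 2 ^+ n => c1.
have := mulr_ge0 (mulr_ge0 (_ : 0 <= c - 1) (_ : 0 <= 2 - z)) (_ : 0 <= z - 1).
rewrite !subr_ge0 => /(_ c1 z2 z1); nra.
Qed.

(** What matters is that [x] keeps the coefficient 1: removing mass [x] must bring a gain of full
    linear order, while adding mass [y] may cost a large constant. Below 1 the power is at most its
    base; above 1 the chord bound applies. *)
Lemma powR_le_linear (ga : R) : 1 <= ga -> exists2 C, 1 <= C & forall x y : R,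
  0 <= x <= 1 -> 0 <= y <= 1 -> powR (1 - x + y) ga <= 1 - x + C * y.
Proof.
move=> ga1; have ga0 : 0 <= ga by rewrite (le_trans _ ga1).
pose n := Num.bound ga.
have gan : ga <= n%:R by apply/ltW/archi_boundP.
have n1 : 1 <= 2 ^+ n :> R by rewrite exprn_ege1// ler1n.
exists (2 ^+ n) => // x y /andP[x0 x1] /andP[y0 y1].
set z := 1 - x + y; have z0 : 0 <= z by rewrite /z; lra.
have yC : y <= 2 ^+ n * y by rewrite ler_peMl.
have [zl|zl] := leP z 1.
  apply: (@le_trans _ _ z); last by rewrite /z lerD2l.
  move: z0; rewrite le_eqVlt => /predU1P[<-|z0].
    by rewrite powR0// gt_eqF// (lt_le_trans _ ga1).
  by apply: ge1r_powR => //; rewrite z0 zl.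
apply: (@le_trans _ _ (z ^+ n)).
  by rewrite -powR_mulrn//; apply: ler_powR => //; exact: ltW.
have z12 : 1 <= z <= 2 by rewrite (ltW zl)/= /z; lra.
apply: le_trans (expr_le_linear n z12) _.
have := mulr_ge0 (_ : 0 <= 2 ^+ n - 1) x0; rewrite subr_ge0 => /(_ n1).
by rewrite /z in zl *; nra.
Qed.

End Powers.

(** * The level: scaling, finiteness and sign *)

Section Level.
Variable R : realType.
Variable p : R.
Hypothesis p26 : 2 < p < 6.
Local Notation mu := (@lebesgue_measure R).
Local Notation Int := (Rintegral mu).
Local Notation itg D f := (mu.-integrable D (EFin \o f)).
Local Notation hl := [set` `[0 : R, +oo[%R].
Local Notation beta := ((p - 2) / (6 - p)).
Local Notation gamma := (1 + 2 * beta).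
Local Notation q := ((p - 2) / 2).
Implicit Types (f g : R -> R).

Let p2 : 2 < p. Proof. by case/andP: p26. Qed.
Let p6 : p < 6. Proof. by case/andP: p26. Qed.
Let p0 : 0 < p. Proof. exact: lt_trans p2. Qed.
Let q02 : 0 <= q < 2. Proof. by apply/andP; split; move: p2 p6; lra. Qed.
Lemma beta_gt0 : 0 < beta.
Proof. by rewrite divr_gt0 ?subr_gt0. Qed.

Lemma gamma_ge1 : 1 <= gamma.
Proof. by rewrite lerDl mulr_ge0// ltW// beta_gt0. Qed.

(** The mass condition is [al ^ 2 = rho * b]. Equal factors for kinetic energy and potential require
    [al ^ (p - 2) = b ^ 2]; solving gives [b = rho ^ beta], and the common factor is
    [rho * b ^ 2 = rho ^ gamma]. *)
Lemma scaling f g (rho : R) : hsobolev f g -> 0 < rho ->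
  exists w dw, [/\ hsobolev w dw, f 0 = 0 -> w 0 = 0, hmass w = rho * hmass f
    & henergy p w dw = powR rho gamma * henergy p f g].
Proof.
move=> fg rho0.
pose b := powR rho beta; pose al := powR rho ((1 + beta) / 2).
have b0 : 0 < b by exact: powR_gt0.
have al0 : 0 < al by exact: powR_gt0.
have p6' : 6 - p != 0 by rewrite subr_eq0 gt_eqF.
have al2 : al ^+ 2 = rho * b.
  rewrite /al /b -powR_mulrn ?powR_ge0// -powRrM.
  have -> : (1 + beta) / 2 * 2 = 1 + beta by field.
  by rewrite gt0_powRD// powRr1// ltW.
have bb : b ^+ 2 * rho = powR rho gamma.
  rewrite /b -powR_mulrn ?powR_ge0// -powRrM mulrC gt0_powRD//.
  by rewrite powRr1 ?(ltW rho0)// (mulrC beta).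
have alp : powR `|al| p = b * powR rho gamma.
  rewrite ger0_norm ?powR_ge0// /al /b -powRrM -gt0_powRD//.
  by congr (powR _ _); field.
exists (fun x => al * f (b * x + 0)), (fun x => al * b * g (b * x + 0)); split.
- exact: affine_hsobolev.
- by rewrite mulr0 addr0 => ->; rewrite mulr0.
- rewrite /hmass (affine_mass al fg b0 (lexx 0)) al2; congr (_ * _).
  by rewrite mulfK// gt_eqF.
- rewrite /henergy /hkin /hpot (affine_kinetic al fg b0 (lexx 0)).
  rewrite (affine_potential al b0 (lexx 0) (hpot_integrable p2 fg)) al2 alp.
  rewrite -bb; set T := Rintegral _ _ _; set P := Rintegral _ _ _.
  by field; rewrite !gt_eqF.
Qed.

Definition admissible_energies : set R :=
  [set E | exists f g, [/\ hsobolev f g, f 0 = 0, hmass f = 1 & E = henergy p f g]].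

(* This is the ground state level of the line, in a form that needs no cut-offs:
   functions vanishing at the origin can be extended by zero. *)
Definition level : R := inf admissible_energies.

Lemma hpot_le_young f g (t : R) : hsobolev f g -> 0 < t ->
  hpot p f <= powR (t * hmass f + hkin g / t) q * hmass f.
Proof.
move=> fg t0; apply: (@hpot_le _ p f g) => // x x0; exact: hsobolev_sup fg t0 x0.
Qed.

(** Only negative energies matter. For them the kinetic energy is at most the potential because
    [p > 2], and the interpolation bound turns this into the self-bound of
    [sublinear_fixpoint_bound], whose shape [1 + 4 * _] is dictated by the later estimate on K. *)
Lemma admissible_lower_bound : has_lbound admissible_energies.
Proof.
have [C C1 hC] := sublinear_fixpoint_bound q02.
have B0 := powR_ge0 (1 + C) q.
exists (- powR (1 + C) q) => _ [f [g [fg f0 f1 ->]]].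
have T0 := hkin_ge0 g; have P0 := hpot_ge0 p f.
have pV : p^-1 <= 2^-1 by rewrite lef_pV2 ?posrE// ltW.
have pV0 : 0 < p^-1 by rewrite invr_gt0.
have [E0|E0] := leP 0 (henergy p f g); first by rewrite (le_trans _ E0)// oppr_le0.
have TP : hkin g <= hpot p f.
  have e : p^-1 * hpot p f <= 2^-1 * hpot p f by exact: ler_wpM2r.
  by move: E0; rewrite /henergy; lra.
have TC : hkin g <= C.
  apply: hC => // t t0; apply: le_trans TP _.
  apply: le_trans (hpot_le_young fg t0) _; rewrite f1 !mulr1.
  have tT : 0 <= t + hkin g / t by rewrite addr_ge0 ?divr_ge0 ?(ltW t0).
  case/andP: q02 => q0 _; apply: ge0_ler_powR => //; rewrite ?nnegrE//.
    by rewrite addr_ge0// mulr_ge0.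
  lra.
have P1 : hpot p f <= powR (1 + C) q.
  apply: le_trans (hpot_le_young fg ltr01) _; rewrite f1 !mulr1 divr1.
  case/andP: q02 => q0 _; apply: ge0_ler_powR => //; rewrite ?nnegrE ?lerD2l//.
    by rewrite addr_ge0.
  by rewrite addr_ge0// (le_trans _ C1).
have : p^-1 * hpot p f <= hpot p f by rewrite ler_piMl// (le_trans pV)// invf_le1// ler1n.
rewrite /henergy; lra.
Qed.

(** Rescaling to mass 1. Zero mass cannot be normalized, but then the potential is zero and the
    energy is nonnegative. *)
Lemma level_le f g : hsobolev f g -> f 0 = 0 ->
  level * powR (hmass f) gamma <= henergy p f g.
Proof.
move=> fg f0; have := hmass_ge0 f; rewrite le_eqVlt => /predU1P[M0|M0].
  rewrite -M0 powR0 ?mulr0; last by rewrite gt_eqF// (lt_le_trans ltr01 gamma_ge1).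
  have := hpot_le_young fg ltr01; rewrite -M0 !mulr0 => P0.
  have -> : henergy p f g = 2^-1 * hkin g.
    rewrite /henergy (_ : hpot p f = 0); last by apply/le_anti; rewrite P0 hpot_ge0.
    by rewrite mulr0 subr0.
  by rewrite mulr_ge0 ?hkin_ge0 ?invr_ge0.
have MV : 0 < (hmass f)^-1 by rewrite invr_gt0.
have [w [dw [wd w0 wM wE]]] := scaling fg MV.
have : level <= henergy p w dw.
  apply: ge_inf; first exact: admissible_lower_bound.
  exists w, dw; split=> //; first exact: w0.
  by rewrite wM mulVf// gt_eqF.
rewrite wE -(ler_pM2r (powR_gt0 gamma M0)) => h; apply: le_trans h _.
rewrite mulrAC -powRM ?invr_ge0 ?(ltW M0)// mulVf ?gt_eqF// powR1 mul1r //.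
Qed.

Lemma hpot_gt0 f g : hsobolev f g -> f 0 = 1 -> 0 < hpot p f.
Proof.
move=> fg f01; have T0 := hkin_ge0 g.
(* By Cauchy-Schwarz [f] then differs from [f 0 = 1] by at most 1/2 on [[0, s]]. *)
pose s := (4 * (hkin g + 1))^-1.
have s0 : 0 < s by rewrite invr_gt0 mulr_gt0// ltr_wpDl.
have sE : s * (4 * (hkin g + 1)) = 1 by rewrite mulVf// gt_eqF// mulr_gt0// ltr_wpDl.
have S := hsobolev_sobolev s fg.
have h1 : Int `[0, s] (fun=> powR 2^-1 p) <= Int `[0, s] (fun x => powR `|f x| p).
  apply: le_Rintegral => //; first exact: integrable_itv_cst.
    exact: (sobolev_powR_integrable S (ltW p0) (lexx 0) (lexx s)).
  move=> x; rewrite /= in_itv/= => /andP[x0 xs].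
  apply: ge0_ler_powR; rewrite ?nnegrE ?(ltW p0)//.
  have := sobolev_diff2_le S (lexx 0) x0 xs; rewrite f01 subr0.
  set T := Int _ _ => hT.
  have TT : T <= hkin g.
    have [_ [gi _]] := fg.
    by apply: Rintegral_subset => //; [exact: sub_hl | move=> *; exact: sqr_ge0].
  have xT : x * T <= s * hkin g.
    by apply: ler_pM => //; apply: Rintegral_ge0 => *; exact: sqr_ge0.
  have h2 : (f x - 1) ^+ 2 <= 4^-1 by apply: le_trans hT _; lra.
  apply: le_trans (ler_norm _).
  rewrite leNgt; apply/negP => fx; nra.
have h2 : Int `[0, s] (fun x => powR `|f x| p) <= hpot p f.
  apply: Rintegral_subset => //; first exact: sub_hl.
  exact: hpot_integrable fg.
apply: lt_le_trans (le_trans h1 h2).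
by rewrite Rintegral_itv_cst ?(ltW s0)// subr0 mulr_gt0// powR_gt0// invr_gt0.
Qed.

Lemma hmass_gt0 f g : hsobolev f g -> f 0 = 1 -> 0 < hmass f.
Proof.
move=> fg f01; rewrite lt_def hmass_ge0 andbT; apply/negP => /eqP M0.
have T0 := hkin_ge0 g.
(* With this parameter and zero mass, the bound at the origin would read
   [1 <= hkin g / (hkin g + 1)]. *)
have T1 : 0 < hkin g + 1 by rewrite ltr_wpDl.
have := hsobolev_origin fg T1; rewrite f01 M0 mulr0 add0r expr1n.
by rewrite ler_pdivlMr// mul1r leNgt ltrDl ltr01.
Qed.

(** A tent: a line from 1 down to 0 is put before the zero function, then a line from 0 up to 1
    before that. *)
Lemma exists_bump : exists f g, [/\ hsobolev f g, f 0 = 0, 0 < hmass f & 0 < hpot p f].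
Proof.
have z : hsobolev (fun=> 0 : R) (fun=> 0 : R).
  have i0 : itg hl (fun=> 0 ^+ 2 : R).
    by rewrite expr0n/=; exact: integrable0.
  split; [exact: measurable_cst | split; [by []| split; [exact: measurable_cst|split=> // x x0]]].
  by rewrite Rintegral_itv_cst// mul0r addr0.
have [v [dv [vd v0 _ _ _]]] := prepend_line 1 p2 z ltr01.
have [w [dw [wd w0 /andP[wM _] _ wP]]] := prepend_line 0 p2 vd ltr01.
exists w, dw; split => //.
- exact: lt_le_trans (hmass_gt0 vd v0) wM.
- exact: lt_le_trans (hpot_gt0 vd v0) wP.
Qed.

(* Spreading a bump of fixed mass over a length [1 / b] multiplies the kinetic term
   by [b ^ 2] and the potential by [b ^ q], and [q < 2]. *)
Lemma level_lt0 : level < 0.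
Proof.
have [f [g [fg f0 M0 P0]]] := exists_bump.
have T0 := hkin_ge0 g.
pose P' := powR (hmass f) (- (p / 2)) * hpot p f / p.
pose T' := 2^-1 * hkin g / hmass f.
have P'0 : 0 < P' by rewrite divr_gt0// mulr_gt0// powR_gt0.
have T'0 : 0 <= T' by rewrite divr_ge0 ?mulr_ge0 ?invr_ge0// ltW.
have T'1 : 0 < T' + 1 by rewrite ltr_wpDl.
have q2 : 0 < 2 - q by rewrite subr_gt0; case/andP: q02.
(* The rescaled energy is [b ^ 2 * T' - b ^ q * P']; this choice gives [b ^ (2 - q) * T' = P' * T' /
   (T' + 1) < P'], also when [T' = 0]. *)
pose b := powR (P' / (T' + 1)) (2 - q)^-1.
have b0 : 0 < b by rewrite powR_gt0// divr_gt0.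
have bE : powR b (2 - q) = P' / (T' + 1).
  by rewrite -powRrM mulVf ?gt_eqF// powRr1// divr_ge0 ?ltW.
pose al := Num.sqrt (b / hmass f).
have bM0 : 0 <= b / hmass f by rewrite divr_ge0 ?ltW.
have al2 : al ^+ 2 = b / hmass f by rewrite sqr_sqrtr.
have alp : powR `|al| p = powR b q * b * powR (hmass f) (- (p / 2)).
  have -> : powR `|al| p = powR (al ^+ 2) (p / 2).
    rewrite ger0_norm ?sqrtr_ge0// -powR_mulrn ?sqrtr_ge0// -powRrM.
    by congr (powR _ _); field.
  rewrite al2 powRM ?invr_ge0 ?(ltW b0) ?(ltW M0)//; congr (_ * _).
    have -> : p / 2 = q + 1 by field.
    by rewrite gt0_powRD// powRr1// ltW.
  by rewrite -(powR_inv1 (ltW M0)) -powRrM mulN1r.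
have hs := affine_hsobolev al fg b0 (lexx 0).
apply: (@le_lt_trans _ _ (henergy p (fun x => al * f (b * x + 0)) (fun x => al * b * g (b * x + 0)))).
  apply: ge_inf; first exact: admissible_lower_bound.
  exists (fun x => al * f (b * x + 0)), (fun x => al * b * g (b * x + 0)).
  split => //; first by rewrite mulr0 addr0 f0 mulr0.
  rewrite /hmass (affine_mass al fg b0 (lexx 0)) al2 -/(hmass f).
  by field; rewrite !gt_eqF.
rewrite /henergy /hkin /hpot (affine_kinetic al fg b0 (lexx 0)).
rewrite (affine_potential al b0 (lexx 0) (hpot_integrable p2 fg)) al2 alp.
rewrite -/(hkin g) -/(hpot p f).
have -> : 2^-1 * (b / hmass f * b * hkin g) = b ^+ 2 * T'.
  by rewrite /T'; field; rewrite gt_eqF.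
have -> : p^-1 * (powR b q * b * powR (hmass f) (- (p / 2)) / b * hpot p f) = powR b q * P'.
  by rewrite /P'; field; rewrite !gt_eqF.
have -> : b ^+ 2 = powR b q * powR b (2 - q).
  by rewrite -gt0_powRD// addrC subrK powR_mulrn// ltW.
have key (x y : R) : 0 < x -> 0 <= y -> x / (y + 1) * y < x.
  move=> x0 y0; have y1 : 0 < y + 1 by rewrite ltr_wpDl.
  by rewrite mulrAC ltr_pdivrMr// ltr_pM2l// ltrDl.
rewrite bE subr_lt0 -[ltLHS]mulrA ltr_pM2l; last exact: powR_gt0.
exact: key.
Qed.

(** A ramp of length [l] down to 0 makes the function admissible for [level_le]. As the level is
    negative, an upper bound for the new mass is the useful direction. *)
Lemma level_le_ramp f g (l : R) : hsobolev f g -> 0 < l ->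
  level * powR (hmass f + f 0 ^+ 2 * l) gamma - f 0 ^+ 2 / (2 * l) <= henergy p f g.
Proof.
move=> fg l0.
have [w [dw [wd w0 /andP[_ wM] wT wP]]] := prepend_line 0 p2 fg l0.
have := level_le wd w0.
rewrite expr0n/= add0r in wM; rewrite subr0 in wT.
have g0 : 0 <= gamma := le_trans ler01 gamma_ge1.
have h1 : level * powR (hmass f + f 0 ^+ 2 * l) gamma <= level * powR (hmass w) gamma.
  rewrite ler_wnM2l ?(ltW level_lt0)//; apply: ge0_ler_powR => //; rewrite ?nnegrE ?hmass_ge0//.
  by rewrite (le_trans (hmass_ge0 w)).
have h2 : p^-1 * hpot p f <= p^-1 * hpot p w by rewrite ler_pM2l// invr_gt0.
rewrite /henergy wT mulrDr.
have -> : 2^-1 * (f 0 ^+ 2 / l) = f 0 ^+ 2 / (2 * l) by field; rewrite gt_eqF.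
lra.
Qed.

End Level.

(** * Tails of functions on the halfline *)

Section Tail.
Variable R : realType.
Local Notation mu := (@lebesgue_measure R).
Local Notation Int := (Rintegral mu).
Implicit Types (p : R) (f g : R -> R).

Lemma hsobolev_tail p f g (c : R) : 2 < p -> hsobolev f g -> 0 <= c ->
  exists w dw, [/\ hsobolev w dw, forall x, w x = f (x + c),
    hmass f = Int `[0, c] (fun x => f x ^+ 2) + hmass w,
    hkin g = Int `[0, c] (fun x => g x ^+ 2) + hkin dw &
    hpot p f = Int `[0, c] (fun x => powR `|f x| p) + hpot p w].
Proof.
move=> p2 fg c0; have [_ [gi [_ [fi _]]]] := fg.
exists (fun x => 1 * f (1 * x + c)), (fun x => 1 * 1 * g (1 * x + c)); split.
- exact: affine_hsobolev.
- by move=> x; rewrite !mul1r.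
- rewrite /hmass (affine_mass 1 fg ltr01 c0) expr1n invr1 !mul1r.
  exact: (@Rintegral_cat _ (fun x => f x ^+ 2) 0 c +oo%O).
- rewrite /hkin (affine_kinetic 1 fg ltr01 c0) expr1n !mul1r.
  exact: (@Rintegral_cat _ (fun x => g x ^+ 2) 0 c +oo%O).
- have Pi := hpot_integrable p2 fg.
  rewrite /hpot (affine_potential 1 ltr01 c0 Pi) normr1 powR1 invr1 !mul1r.
  exact: (@Rintegral_cat _ (fun x => powR `|f x| p) 0 c +oo%O).
Qed.

Lemma sobolev_vanish_bound (f g : R -> R) (l x : R) : sobolev l f g -> f 0 = 0 ->
  0 <= x <= l -> f x ^+ 2 <= l * Int `[0, l] (fun x => g x ^+ 2).
Proof.
move=> S f0 /andP[x0 xl].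
have := sobolev_diff2_le S (lexx 0) x0 xl; rewrite f0 !subr0 => h.
apply: le_trans h _; apply: ler_pM => //; first exact: sobolev_deriv2_ge0.
by rewrite (sobolev_deriv2_cat S (lexx 0) x0 xl (lexx l)) lerDl sobolev_deriv2_ge0.
Qed.

End Tail.

(** The linear bookkeeping of [minimizer_cut]: [L] is the level at mass [m], [A] the level at the
    mass after the ramp, [E] the energy of the tail, and [t] and [P] are the kinetic term and the
    weighted potential on [[0, eta]]. *)
Lemma cut_balance (R : realType) (L A E P t d Ks Ke s h : R) :
  L - Ks <= A -> A - s / 2 <= E -> E + 2^-1 * t - P <= L -> P <= d -> Ks <= Ke ->
  s / 2 <= h -> t * 2^-1 <= d + Ke + h.
Proof. by lra. Qed.

(** * The level is not attained *)

Section NotAttained.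
Variable R : realType.
Variable p : R.
Hypothesis p26 : 2 < p < 6.
Local Notation mu := (@lebesgue_measure R).
Local Notation Int := (Rintegral mu).
Local Notation hl := [set` `[0 : R, +oo[%R].
Local Notation beta := ((p - 2) / (6 - p)).
Local Notation gamma := (1 + 2 * beta).
Local Notation q := ((p - 2) / 2).
Local Notation level := (level p).
Implicit Types (f g : R -> R).

Let p2 : 2 < p. Proof. by case/andP: p26. Qed.
Let p0 : 0 < p. Proof. exact: lt_trans p2. Qed.

Section Minimizer.
Variables (m T C eta : R).
Hypotheses (m0 : 0 < m) (eta0 : 0 < eta) (eta1 : eta <= 1) (etaT : eta * T <= m).
Hypothesis hC : forall x y : R, 0 <= x <= 1 -> 0 <= y <= 1 ->
  powR (1 - x + y) gamma <= 1 - x + C * y.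
Let B := m + T.
Hypothesis C1 : 1 <= C.
Hypothesis eta_small :
  eta * (powR B q / p + (- level * powR m gamma * (C / m)) + 2^-1) < 2^-1.

(** Mass and kinetic energy are prescribed because [eta] depends on them: a tail of a minimizer that
    starts after an interval of vanishing keeps both, so the same [eta] works again. *)
Let minimizer f g :=
  [/\ hsobolev f g, f 0 = 0, hmass f = m, hkin g = T & henergy p f g <= level * powR m gamma].

(* Replacing the part of a minimizer on [0, eta] by a linear ramp of unit length
   would lower the energy by a multiple of the kinetic energy on [0, eta]. *)
Lemma minimizer_cut f g : minimizer f g -> Int `[0, eta] (fun x => g x ^+ 2) = 0.
Proof.
move=> [fg f0 fm fT fE]; have S := hsobolev_sobolev eta fg.
have [w [dw [wd wE mE TE PE]]] := hsobolev_tail p2 fg (ltW eta0).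
set Te := Int `[0, eta] (fun x => g x ^+ 2).
have Te0 : 0 <= Te := sobolev_deriv2_ge0 g 0 eta.
have TeT : Te <= T by rewrite -fT TE lerDl hkin_ge0.
have fle x : 0 <= x <= eta -> f x ^+ 2 <= eta * Te by exact: sobolev_vanish_bound.
have BE : B = 1 * hmass f + hkin g / 1 by rewrite fm fT mul1r divr1.
(* As [f 0 = 0], [f ^ 2] is at most [eta * Te] on [[0, eta]]; the potential given up is of order
   [eta ^ 2 * Te], negligible against [Te / 2]. *)
have Pe : Int `[0, eta] (fun x => powR `|f x| p) <= powR B q * (eta * Te) * (eta - 0).
  rewrite -Rintegral_itv_cst ?(ltW eta0)//; apply: le_Rintegral => //.
  - exact: (sobolev_powR_integrable S (ltW p0) (lexx 0) (lexx _)).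
  - exact: integrable_itv_cst.
  - move=> x; rewrite /= in_itv/= => xe.
    apply: (@le_trans _ _ (powR B q * f x ^+ 2)).
      apply: powR_norm_le => //; rewrite BE; case/andP: xe => x0 _.
      exact: hsobolev_sup fg ltr01 x0.
    by rewrite ler_wpM2l ?powR_ge0// fle.
set s := w 0 ^+ 2.
have s0 : 0 <= s by exact: sqr_ge0.
have sTe : s <= eta * Te by rewrite /s wE add0r fle// lexx ltW.
have sm : s <= m by apply: le_trans sTe _; apply: le_trans etaT; rewrite ler_pM2l.
have mw : hmass w <= m by rewrite -fm mE lerDr; apply: Rintegral_ge0 => *; exact: sqr_ge0.
have lev := level_lt0 p26.
have ramp := level_le_ramp p26 wd ltr01; rewrite -/s !mulr1 in ramp.
have g0 : 0 <= gamma := le_trans ler01 (gamma_ge1 p26).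
have pw : powR (hmass w + s) gamma <= powR m gamma * (1 + C * (s / m)).
  apply: (@le_trans _ _ (powR (m * (1 - 0 + s / m)) gamma)).
    apply: ge0_ler_powR => //; rewrite ?nnegrE.
    - by rewrite addr_ge0 ?hmass_ge0.
    - by rewrite mulr_ge0 ?(ltW m0)// subr0 addr_ge0// divr_ge0// ltW.
    - by rewrite subr0 mulrDr mulr1 mulrCA divff ?gt_eqF// mulr1 lerD2r.
  have sm' : 0 <= s / m <= 1.
    by rewrite divr_ge0 ?(ltW m0)//= ler_pdivrMr// mul1r.
  rewrite powRM ?(ltW m0)//; last by rewrite subr0 addr_ge0//; case/andP: sm'.
  rewrite ler_wpM2l ?powR_ge0//.
  have o0 : 0 <= (0 : R) <= 1 by rewrite lexx ler01.
  by have := hC o0 sm'; rewrite !subr0.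
have pw' : level * (powR m gamma * (1 + C * (s / m))) <= level * powR (hmass w + s) gamma.
  by rewrite ler_wnM2l// ltW.
have EE : henergy p f g = henergy p w dw + 2^-1 * Te - p^-1 * Int `[0, eta] (fun x => powR `|f x| p).
  rewrite /henergy PE TE -/Te; set P := Int _ _; ring.
have Pe' : p^-1 * Int `[0, eta] (fun x => powR `|f x| p) <= eta * (powR B q / p) * Te.
  apply: (@le_trans _ _ (p^-1 * (powR B q * (eta * Te) * (eta - 0)))).
    by rewrite ler_pM2l ?invr_gt0.
  have -> : p^-1 * (powR B q * (eta * Te) * (eta - 0)) = (powR B q / p * eta * Te) * eta by rewrite subr0; ring.
  have -> : eta * (powR B q / p) * Te = (powR B q / p * eta * Te) * 1 by ring.
  rewrite ler_wpM2l// !mulr_ge0 ?powR_ge0 ?invr_ge0 ?(ltW eta0) ?(ltW p0)//.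
have small := eta_small; set K1 := - level * powR m gamma * (C / m) in small.
have K10 : 0 <= K1.
  by rewrite /K1 !mulr_ge0 ?powR_ge0 ?oppr_ge0 ?(ltW lev) ?invr_ge0 ?(ltW m0)// (le_trans _ C1).
have K1s : level * (powR m gamma * (1 + C * (s / m))) = level * powR m gamma - K1 * s.
  by rewrite /K1; ring.
have K1s' : K1 * s <= K1 * (eta * Te) by rewrite ler_wpM2l.
(* The cut saves [Te / 2]; lost potential, added mass and the slope of the ramp each cost at most a
   constant times [eta * Te]. By [eta_small] this forces [Te = 0]. *)
have main : Te * 2^-1 <= Te * (eta * (powR B q / p + K1 + 2^-1)).
  move: fE; rewrite EE => fE.
  have -> : Te * (eta * (powR B q / p + K1 + 2^-1)) =
     eta * (powR B q / p) * Te + K1 * (eta * Te) + 2^-1 * (eta * Te) by ring.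
  have s2 : s / 2 <= 2^-1 * (eta * Te) by rewrite mulrC ler_pM2l ?invr_gt0.
  rewrite K1s in pw'.
  exact: cut_balance pw' ramp fE Pe' K1s' s2.
apply/le_anti; rewrite Te0 andbT leNgt; apply/negP => Tp.
by move: main; rewrite ler_pM2l// leNgt small.
Qed.

(** Zero kinetic energy on [[0, eta]] and [f 0 = 0] give [f = 0] there; the tail beyond [eta] is
    again a minimizer with the same data, and the induction advances by [eta]. *)
Lemma minimizer_vanish n f g : minimizer f g -> forall x, 0 <= x <= n%:R * eta -> f x = 0.
Proof.
elim: n f g => [|n IH] f g fgm x.
  rewrite mul0r => /le_anti <-; by case: fgm.
move=> /andP[x0 xn]; have Te := minimizer_cut fgm.
case: (fgm) => [fg f0 fm fT fE]; have S := hsobolev_sobolev eta fg.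
have fz y : 0 <= y <= eta -> f y = 0.
  move=> ye; have := sobolev_vanish_bound S f0 ye; rewrite Te mulr0 => h.
  by apply/eqP; rewrite -sqrf_eq0 -[_ == 0]andbT eq_le h sqr_ge0.
have [xe|ex] := leP x eta; first by rewrite fz// x0.
have [w [dw [wd wE mE TE PE]]] := hsobolev_tail p2 fg (ltW eta0).
have z2 : Int `[0, eta] (fun x => f x ^+ 2) = 0.
  rewrite -[RHS](mul0r (eta - 0)) -Rintegral_itv_cst ?(ltW eta0)//.
  by apply: eq_Rintegral => y; rewrite inE/= in_itv/= => ye; rewrite fz// expr0n.
have zp : Int `[0, eta] (fun x => powR `|f x| p) = 0.
  rewrite -[RHS](mul0r (eta - 0)) -Rintegral_itv_cst ?(ltW eta0)//.
  apply: eq_Rintegral => y; rewrite inE/= in_itv/= => ye.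
  by rewrite fz// normr0 powR0// gt_eqF.
rewrite z2 add0r in mE; rewrite Te add0r in TE; rewrite zp add0r in PE.
have wm : minimizer w dw.
  split => //; first by rewrite wE add0r fz// lexx ltW.
  - by rewrite -mE.
  - by rewrite -TE.
  - by rewrite /henergy -TE -PE.
have := IH w dw wm (x - eta); rewrite wE subrK; apply.
by rewrite subr_ge0 (ltW ex) lerBlDr -[X in _ + X]mul1r -mulrDl natr1.
Qed.

End Minimizer.

Lemma level_not_attained f g : hsobolev f g -> f 0 = 0 -> 0 < hmass f ->
  level * powR (hmass f) gamma < henergy p f g.
Proof.
move=> fg f0 m0; rewrite ltNge; apply/negP => fE.
have [C C1 hC] := powR_le_linear (gamma_ge1 p26).
set m := hmass f in m0 fE; pose T := hkin g.
have T0 : 0 <= T := hkin_ge0 g.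
have lev := level_lt0 p26.
pose D := powR (m + T) q / p + (- level * powR m gamma * (C / m)) + 2^-1.
have D0 : 0 < D.
  have h1 : 0 <= powR (m + T) q / p by rewrite divr_ge0 ?powR_ge0// ltW.
  have h2 : 0 <= - level * powR m gamma * (C / m).
    by rewrite !mulr_ge0 ?powR_ge0 ?oppr_ge0 ?(ltW lev) ?invr_ge0 ?(ltW m0)// (le_trans _ C1).
  by rewrite /D; lra.
(* One summand for each requirement on [eta = 1 / S]: [eta <= 1], [eta * T <= m], and
   [eta * D <= 1/3 < 1/2]. *)
pose S := 1 + T / m + 3 * D.
have Tm0 : 0 <= T / m by rewrite divr_ge0// ltW.
have S0 : 0 < S by rewrite /S; lra.
pose eta := S^-1.
have eta0 : 0 < eta by rewrite invr_gt0.
have etaS : eta * S = 1 by rewrite mulVf// gt_eqF.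
have eta1 : eta <= 1.
  by rewrite -etaS ler_peMr ?(ltW eta0)// /S; lra.
have etaT : eta * T <= m.
  rewrite -[leRHS]mul1r -ler_pdivrMr// -mulrA -etaS ler_pM2l// /S; lra.
have eta_small : eta * D < 2^-1.
  have : eta * (3 * D) <= 1 by rewrite -[leRHS]etaS ler_pM2l// /S; lra.
  have : 0 < eta * D by rewrite mulr_gt0.
  lra.
have van := @minimizer_vanish m T C eta m0 eta0 eta1 etaT hC C1 eta_small.
have fz x : 0 <= x -> f x = 0.
  move=> x0; pose n := Num.bound (x / eta).
  apply: (van n f g) => //; rewrite x0/= -ler_pdivrMr//.
  by apply/ltW/archi_boundP; rewrite divr_ge0// ltW.
have : m = 0.
  rewrite /m /hmass; transitivity (Int hl (fun=> 0)).
    by apply: eq_Rintegral => x; rewrite inE/= in_itv/= andbT => x0; rewrite fz// expr0n.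
  by rewrite Rintegral_cst// mul0r.
by move/eqP; rewrite gt_eqF.
Qed.

End NotAttained.

(** * Walks, distances and oscillation on K *)

Section Walks.
Variables (R : realType) (K : cgraph R).
Local Notation E := 'I_(ne K).
Local Notation V := 'I_(nv K).
Implicit Types (s : seq (E * bool)) (a b : V) (eb : E * bool).

Definition step_start eb : V := if eb.2 then src eb.1 else dst eb.1.

Lemma walk_exists a b : exists s, walk_ok a b s.
Proof.
have [s sok] := walk_connected a b; exists s.
by elim: s a sok => [|eb s IH] a //= [h1 h2]; split => //; exact: IH.
Qed.

Lemma walk_len_ge0 s : 0 <= walk_len s.
Proof. by apply: sumr_ge0 => eb _; exact/ltW/len_pos. Qed.

Lemma walk_suffix a b s1 eb s2 : walk_ok a b (s1 ++ eb :: s2) ->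
  walk_ok (step_start eb) b (eb :: s2).
Proof.
elim: s1 a => [|eb1 s1 IH] a /=; first by move=> [_ h]; split.
by move=> [_ /IH].
Qed.

Lemma walk_len_suffix s1 s2 : walk_len s2 <= walk_len (s1 ++ s2).
Proof. by rewrite /walk_len big_cat/= lerDr; exact: walk_len_ge0. Qed.

Lemma simple_walk a b s : walk_ok a b s ->
  exists s', [/\ walk_ok a b s', uniq (map fst s') & walk_len s' <= walk_len s].
Proof.
elim: s a => [|eb s IH] a /=; first by move=> ->; exists [::].
move=> [ha /IH [s' [ok us ls]]].
have lencons (t : seq (E * bool)) : walk_len (eb :: t) = len eb.1 + walk_len t.
  by rewrite /walk_len big_cons.
have len0 := ltW (len_pos eb.1).
have [|nin] := boolP (eb.1 \in map fst s'); last first.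
  by exists (eb :: s'); split => //=; rewrite ?nin// !lencons lerD2l.
case/mapP => eb' eb'in ebE.
case/splitPr: eb'in ok us ls => s1 s2 ok us ls.
have suf := walk_suffix ok.
move: us; rewrite map_cat cat_uniq => /and3P[_ _ us].
have ls2 := le_trans (walk_len_suffix s1 (eb' :: s2)) ls.
have [eb2|eb2] := eqVneq eb'.2 eb.2.
  have ebeq : eb' = eb by rewrite [eb']surjective_pairing [eb]surjective_pairing ebE eb2.
  exists (eb' :: s2); split => //.
    by rewrite -ha -[X in walk_ok X]/(step_start eb) -ebeq.
  by rewrite lencons (le_trans ls2)// lerDr.
exists s2; split.
- case: suf => _; rewrite -ha -ebE.
  by move: eb2; case: (eb'.2); case: (eb.2).
- by move: us => /= /andP[].
- rewrite lencons (le_trans _ (le_trans ls2 _)) ?lerDr//.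
  by rewrite -cat1s; exact: walk_len_suffix.
Qed.

Lemma vdist_walk_len a b : has_lbound [set r | exists s, walk_ok a b s /\ r = walk_len s].
Proof. by exists 0 => _ [s [_ ->]]; exact: walk_len_ge0. Qed.

Lemma vdist_ge0 a b : 0 <= vdist a b.
Proof.
apply: lb_le_inf; last by move=> _ [s [_ ->]]; exact: walk_len_ge0.
by have [s sok] := walk_exists a b; exists (walk_len s), s.
Qed.

Lemma vdist_simple_walk a b (r : R) : vdist a b < r ->
  exists s, [/\ walk_ok a b s, uniq (map fst s) & walk_len s < r].
Proof.
move=> dr.
have hi : has_inf [set r | exists s, walk_ok a b s /\ r = walk_len s].
  split; last exact: vdist_walk_len.
  by have [s sok] := walk_exists a b; exists (walk_len s), s.
have r0 : 0 < r - vdist a b by rewrite subr_gt0.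
have [_ [s [sok ->]] lt] := inf_adherent r0 hi.
have [s' [ok' us' le']] := simple_walk sok.
exists s'; split => //; apply: le_lt_trans le' _.
by apply: lt_le_trans lt _; rewrite addrC -/(vdist a b) subrK.
Qed.

Lemma sum_uniq_le (W : E -> R) (s : seq E) : (forall e, 0 <= W e) -> uniq s ->
  \sum_(e <- s) W e <= \sum_(e < ne K) W e.
Proof.
move=> W0 us; rewrite big_uniq//= [leRHS](bigID (mem s))/= lerDl.
by apply: sumr_ge0.
Qed.

Lemma len_le_length (e : E) : len e <= length K.
Proof.
rewrite /length (bigD1 e)//= lerDl; apply: sumr_ge0 => e' _; exact/ltW/len_pos.
Qed.

Lemma length_gt0 : 0 < length K.
Proof. by apply: lt_le_trans (len_le_length (Ordinal (ne_pos K))); exact: len_pos. Qed.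

Local Notation ends P := [:: (src P.1, P.2); (dst P.1, len P.1 - P.2)].
Local Notation through P Q :=
  [seq c.2 + vdist c.1 d.1 + d.2 | c <- ends P, d <- ends Q].
Local Notation cands P Q := (if P.1 == Q.1 then `|P.2 - Q.2| :: through P Q else through P Q).

Lemma ends_ge0 (P : E * R) (a : V * R) : is_point P -> a \in ends P -> 0 <= a.2.
Proof.
move=> /andP[P0 P1]; rewrite !inE => /orP[] /eqP -> //=.
by rewrite subr_ge0.
Qed.

Lemma cands_ge0 (P Q : E * R) r : is_point P -> is_point Q -> r \in cands P Q -> 0 <= r.
Proof.
move=> hP hQ; have th : r \in through P Q -> 0 <= r.
  case/allpairsP => -[a b] [/= aP bQ ->].
  by rewrite !addr_ge0 ?vdist_ge0 ?(ends_ge0 hP aP) ?(ends_ge0 hQ bQ).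
by case: ifP => // _; rewrite in_cons => /orP[/eqP ->|//]; exact: normr_ge0.
Qed.

Lemma through_cands (P Q : E * R) r : r \in through P Q -> r \in cands P Q.
Proof. by move=> h; case: ifP => // _; rewrite in_cons h orbT. Qed.

Lemma first_through (P Q : E * R) : P.2 + vdist (src P.1) (src Q.1) + Q.2 \in through P Q.
Proof.
apply/allpairsP; exists ((src P.1, P.2), (src Q.1, Q.2)).
by split => //; rewrite inE eqxx.
Qed.

Lemma pdist_has_inf (P Q : E * R) : is_point P -> is_point Q ->
  has_inf [set r | r \in cands P Q].
Proof.
move=> hP hQ; split; last by exists 0 => r; exact: cands_ge0.
exists (P.2 + vdist (src P.1) (src Q.1) + Q.2); apply: through_cands; exact: first_through.
Qed.

Lemma pdist_ge0 (P Q : E * R) : is_point P -> is_point Q -> 0 <= pdist P Q.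
Proof.
move=> hP hQ; apply: lb_le_inf; first by case: (pdist_has_inf hP hQ).
by move=> r; exact: cands_ge0.
Qed.

(** This makes [diam] a genuine supremum. The sum of all vertex distances is a convenient bound for
    each of them. *)
Lemma pdist_bounded : has_ubound [set d | exists P Q : E * R, is_point P /\ is_point Q /\ d = pdist P Q].
Proof.
exists (length K + \sum_(v < nv K) \sum_(w < nv K) vdist v w + length K).
move=> _ [P [Q [hP [hQ ->]]]].
apply: (@le_trans _ _ (P.2 + vdist (src P.1) (src Q.1) + Q.2)).
  apply: ge_inf; first by case: (pdist_has_inf hP hQ).
  by apply: through_cands; exact: first_through.
case/andP: hP => _ hP; case/andP: hQ => _ hQ.
apply: lerD; last exact: le_trans hQ (len_le_length _).
apply: lerD; first exact: le_trans hP (len_le_length _).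
rewrite (bigD1 (src P.1))//= (bigD1 (src Q.1))//= -addrA lerDl addr_ge0//.
- by apply: sumr_ge0 => *; exact: vdist_ge0.
- by apply: sumr_ge0 => *; apply: sumr_ge0 => *; exact: vdist_ge0.
Qed.

Lemma pdist_le_diam (P Q : E * R) : is_point P -> is_point Q -> pdist P Q <= diam K.
Proof.
by move=> hP hQ; apply: sup_ubound; [exact: pdist_bounded | exists P, Q].
Qed.

Lemma diam_ge0 : 0 <= diam K.
Proof.
pose P : E * R := (Ordinal (ne_pos K), 0).
have hP : is_point P by rewrite /is_point/= lexx ltW// len_pos.
exact: le_trans (pdist_ge0 hP hP) (pdist_le_diam hP hP).
Qed.

Lemma vertex_on_edge (v : V) : exists e : E, v = src e \/ v = dst e.
Proof.
have [[|[e b] s] /=] := walk_exists v (src (Ordinal (ne_pos K))).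
  by move=> ->; exists (Ordinal (ne_pos K)); left.
by move=> [<- _]; exists e; case: b; [left|right].
Qed.

Section Oscillation.
Variables (F : E -> R -> R) (phi : V -> R) (A : R) (W : E -> R).
Hypotheses (A0 : 0 <= A) (W0 : forall e, 0 <= W e).
Hypothesis Fsrc : forall e, F e 0 = phi (src e).
Hypothesis Fdst : forall e, F e (len e) = phi (dst e).
Hypothesis Fosc : forall e (x y : R), 0 <= x -> x <= y -> y <= len e ->
  `|F e y - F e x| <= A * (y - x) + W e.

(** The edgewise bound has two parts: one proportional to length, which adds up to the length of the
    walk, and one tied to the edge, which a simple walk counts once. *)
Lemma walk_oscillation a b s : walk_ok a b s ->
  `|phi a - phi b| <= A * walk_len s + \sum_(eb <- s) W eb.1.
Proof.
elim: s a => [|eb s IH] a /=.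
  by move=> ->; rewrite subrr normr0 /walk_len !big_nil mulr0 addr0.
move=> [<- /IH]; rewrite /walk_len !big_cons.
set c := if eb.2 then dst _ else _ => h.
have h1 : `|phi (if eb.2 then src eb.1 else dst eb.1) - phi c| <= A * len eb.1 + W eb.1.
  have := Fosc (lexx 0) (ltW (len_pos eb.1)) (lexx _).
  by rewrite Fsrc Fdst subr0 /c; case: (eb.2); rewrite // distrC.
apply: le_trans (ler_distD (phi c) _ _) _; apply: le_trans (lerD h1 h) _.
by rewrite mulrDr addrACA.
Qed.

Lemma ends_oscillation (P : E * R) (a : V * R) : is_point P -> a \in ends P ->
  `|F P.1 P.2 - phi a.1| <= A * a.2 + W P.1.
Proof.
move=> /andP[P0 P1]; rewrite !inE => /orP[] /eqP -> /=.
  by have := Fosc (lexx 0) P0 P1; rewrite Fsrc subr0.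
by have := Fosc P0 P1 (lexx _); rewrite Fdst distrC.
Qed.

(* A simple walk uses each edge once; the two end segments may reuse edges of the
   walk, whence the factor 3. *)
Lemma oscillation_le (P Q : E * R) (D : R) : is_point P -> is_point Q -> diam K < D ->
  `|F P.1 P.2 - F Q.1 Q.2| <= A * D + 3 * \sum_(e < ne K) W e.
Proof.
move=> hP hQ dD.
have WS e : W e <= \sum_(e < ne K) W e.
  by rewrite (bigD1 e)//= lerDl; apply: sumr_ge0 => *.
have SW0 : 0 <= \sum_(e < ne K) W e by exact: sumr_ge0.
have pD : pdist P Q < D := le_lt_trans (pdist_le_diam hP hQ) dD.
have r0 : 0 < D - pdist P Q by rewrite subr_gt0.
have [r /= rc] := inf_adherent r0 (pdist_has_inf hP hQ).
rewrite addrC -/(pdist P Q) subrK => rD.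
have th : r \in through P Q -> `|F P.1 P.2 - F Q.1 Q.2| <= A * D + 3 * \sum_(e < ne K) W e.
  case/allpairsP => -[a b] [/= aP bQ rE].
  have vd : vdist a.1 b.1 < D - a.2 - b.2.
    by rewrite ltrBrDr ltrBrDr (le_lt_trans _ rD)// rE addrAC (addrC (vdist _ _)) addrAC.
  have [s [ok us sl]] := vdist_simple_walk vd.
  have h1 := ends_oscillation hP aP; have h2 := ends_oscillation hQ bQ.
  have h3 := walk_oscillation ok.
  have h4 : \sum_(eb <- s) W eb.1 <= \sum_(e < ne K) W e.
    by rewrite -(big_map fst xpredT W); exact: sum_uniq_le.
  have h5 : A * walk_len s <= A * (D - a.2 - b.2) by rewrite ler_wpM2l// ltW.
  have t1 := ler_distD (phi a.1) (F P.1 P.2) (F Q.1 Q.2).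
  have t2 := ler_distD (phi b.1) (phi a.1) (F Q.1 Q.2).
  rewrite (distrC (phi b.1)) in t2.
  have w1 := WS P.1; have w2 := WS Q.1.
  rewrite !mulrBr in h5; lra.
(* The remaining candidate for the distance is the segment inside a common edge. *)
move: rc; case: ifP => [/eqP e|_ //]; rewrite in_cons => /orP[/eqP rE|//].
have hD : A * r <= A * D by rewrite ler_wpM2l// ltW.
have hW := WS P.1.
suff h : `|F P.1 P.2 - F Q.1 Q.2| <= A * r + W P.1 by lra.
case/andP: hP => P0 P1; case/andP: hQ => Q0 Q1.
rewrite -e in Q1 *; rewrite rE; have [PQ|QP] := leP P.2 Q.2.
  by rewrite distrC (le_trans (Fosc P0 PQ Q1))// distrC ger0_norm ?subr_ge0.
by rewrite (le_trans (Fosc Q0 (ltW QP) P1))// ger0_norm ?subr_ge0// ltW.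
Qed.

End Oscillation.
End Walks.

(** Choose [t = d / a]. This recovers Cauchy-Schwarz across several edges from bounds that are
    additive over edges. *)
Lemma sqr_le_of_young (R : realType) (d a b : R) : 0 <= d -> 0 < a -> 0 <= b ->
  (forall t, 0 < t -> 2 * d <= t * a + b / t) -> d ^+ 2 <= a * b.
Proof.
move=> d0 a0 b0 h; move: d0; rewrite le_eqVlt => /predU1P[<-|d0].
  by rewrite expr0n/= mulr_ge0// ltW.
have t0 : 0 < d / a by rewrite divr_gt0.
have := h _ t0; rewrite mulfVK ?gt_eqF// mulr_natl mulr2n lerD2l.
by rewrite ler_pdivlMr// mulrA -expr2 ler_pdivrMr// [b * a]mulrC.
Qed.

(** * Functions on the whole graph *)

Section GraphFunctions.
Variables (R : realType) (K : cgraph R) (v0 : 'I_(nv K)).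
Local Notation mu := (@lebesgue_measure R).
Local Notation Int := (Rintegral mu).
Local Notation itg D f := (mu.-integrable D (EFin \o f)).
Implicit Types (u : gfun K) (p : R) (P : 'I_(ne K) * R).

Definition kmass u := \sum_(e < ne K) Int `[0, len e] (fun x => fe u e x ^+ 2).
Definition kkin u := \sum_(e < ne K) Int `[0, len e] (fun x => de u e x ^+ 2).
Definition kpot p u := \sum_(e < ne K) Int `[0, len e] (fun x => powR `|fe u e x| p).

Lemma massE u : mass u = kmass u + hmass (fh u).
Proof. by []. Qed.

Lemma energyE p u :
  energy p u = 2^-1 * kkin u - p^-1 * kpot p u + henergy p (fh u) (dh u).
Proof.
have -> : energy p u = 2^-1 * (kkin u + hkin (dh u)) - p^-1 * (kpot p u + hpot p (fh u)) by [].
by rewrite /henergy; ring.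
Qed.

Lemma kmass_ge0 u : 0 <= kmass u.
Proof. by apply: sumr_ge0 => e _; apply: Rintegral_ge0 => *; exact: sqr_ge0. Qed.

Lemma kkin_ge0 u : 0 <= kkin u.
Proof. by apply: sumr_ge0 => e _; apply: Rintegral_ge0 => *; exact: sqr_ge0. Qed.

Lemma kpot_ge0 p u : 0 <= kpot p u.
Proof. by apply: sumr_ge0 => e _; apply: Rintegral_ge0 => *; exact: powR_ge0. Qed.

Section Estimates.
Variable u : gfun K.
Hypothesis Hu : H1 v0 u.

Lemma H1_edge e : sobolev (len e) (fe u e) (de u e).
Proof. by case: Hu => /(_ e). Qed.

Lemma H1_halfline : hsobolev (fh u) (dh u).
Proof. by case: Hu => _ []. Qed.

(** Here the length of K enters: a long K has a point where [u ^ 2] is small. *)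
Lemma kaverage (eta : R) : 0 < eta ->
  exists2 P, is_point P & fe u P.1 P.2 ^+ 2 <= kmass u / length K + eta.
Proof.
move=> eta0; have L0 := length_gt0 K; apply: contrapT => hn.
set c := kmass u / length K + eta in hn.
have hc e : c * len e <= Int `[0, len e] (fun x => fe u e x ^+ 2).
  have l0 := ltW (len_pos e).
  rewrite -[X in c * X]subr0 -Rintegral_itv_cst//; apply: le_Rintegral => //.
  - exact: integrable_itv_cst.
  - exact: (sobolev_sq_integrable (H1_edge e) (lexx 0) (lexx _)).
  - move=> x; rewrite /= in_itv/= => xe; rewrite leNgt; apply/negP => hx.
    by apply: hn; exists (e, x) => //; exact: ltW.
have : c * length K <= kmass u.
  by rewrite /length mulr_sumr; apply: ler_sum.
by rewrite /c mulrDl mulfVK ?gt_eqF// leNgt ltrDl mulr_gt0.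
Qed.

(** The value at a point of [kaverage] is carried to [P]. On each edge Cauchy-Schwarz is weakened to
    [t / 2 * h + Te / (2 * t)] so that it adds up along the walk; optimizing [t] gives a squared
    oscillation of at most [3 * D * kkin u]. The strict [diam K < D] leaves room for near-shortest
    walks. *)
Lemma K_sup_diam (D : R) P : diam K < D -> is_point P ->
  fe u P.1 P.2 ^+ 2 <= 2 * (kmass u / length K) + 6 * (D * kkin u).
Proof.
move=> dD hP; have [_ [_ [phi [hphi _]]]] := Hu.
have D0 : 0 < D := le_lt_trans (diam_ge0 K) dD.
have T0 := kkin_ge0 u.
apply/ler_addgt0Pr => eta eta0.
have eta2 : 0 < eta / 2 by rewrite divr_gt0.
have [Q hQ Qle] := kaverage eta2.
have osc : `|fe u P.1 P.2 - fe u Q.1 Q.2| ^+ 2 <= D * (3 * kkin u).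
  apply: sqr_le_of_young => //; first by rewrite mulr_ge0.
  move=> t t0.
  suff : `|fe u P.1 P.2 - fe u Q.1 Q.2| <= t / 2 * D
      + 3 * \sum_(e < ne K) (Int `[0, len e] (fun x => de u e x ^+ 2) / (2 * t)).
    rewrite -mulr_suml -/(kkin u).
    have -> : t / 2 * D + 3 * (kkin u / (2 * t)) = (t * D + 3 * kkin u / t) / 2.
      by field; rewrite gt_eqF.
    by rewrite ler_pdivlMr// mulrC.
  apply: (@oscillation_le _ K (fe u) phi) => //.
  - by rewrite divr_ge0// ltW.
  - by move=> e; rewrite divr_ge0 ?sobolev_deriv2_ge0// mulr_ge0// ltW.
  - by move=> e; case: (hphi e).
  - by move=> e; case: (hphi e).
  - move=> e x y x0 xy yl.
    have S := H1_edge e.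
    have h := sobolev_diff2_le S x0 xy yl.
    have T2 : Int `[x, y] (fun x => de u e x ^+ 2) <= Int `[0, len e] (fun x => de u e x ^+ 2).
      rewrite (sobolev_deriv2_cat S (lexx 0) (le_trans x0 xy) yl (lexx _)).
      rewrite (sobolev_deriv2_cat S (lexx 0) x0 xy yl).
      by rewrite -addrA addrCA lerDl addr_ge0 ?sobolev_deriv2_ge0.
    set Te := Int `[0, len e] _ in T2 *.
    have Te0 : 0 <= Te := sobolev_deriv2_ge0 (de u e) 0 (len e).
    have h' : `|fe u e y - fe u e x| ^+ 2 <= (y - x) * Te.
      rewrite real_normK ?num_real// (le_trans h)// ler_wpM2l// subr_ge0 //.
    have xy0 : 0 <= y - x by rewrite subr_ge0.
    move: h'; set d := `|_|; set h0 := y - x in xy0 * => h'.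
    have Y0 : 0 <= t / 2 * h0 + Te / (2 * t).
      by rewrite addr_ge0 ?mulr_ge0 ?invr_ge0 ?mulr_ge0// ltW.
    rewrite -(@ler_pXn2r _ 2%N)// ?nnegrE ?normr_ge0//.
    apply: le_trans h' _; rewrite -subr_ge0.
    have -> : (t / 2 * h0 + Te / (2 * t)) ^+ 2 - h0 * Te = (t / 2 * h0 - Te / (2 * t)) ^+ 2.
      by field; rewrite gt_eqF.
    exact: sqr_ge0.
rewrite real_normK ?num_real// in osc.
set a := fe u P.1 P.2 in osc *; set b := fe u Q.1 Q.2 in Qle osc.
set mL := _ / length K in Qle *.
(* The square equals [2 * b ^ 2 + 2 * (a - b) ^ 2 - a ^ 2]. *)
have := sqr_ge0 (a - 2 * b); nra.
Qed.

(** The oscillation bound is applied to [u ^ 2] with [A = 0], so the diameter drops out. This is the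
    form needed for the a priori bound on the kinetic energy. *)
Lemma K_sup_young (lam : R) P : 0 < lam -> is_point P ->
  fe u P.1 P.2 ^+ 2 <= kmass u / length K + 3 * (lam * kmass u + kkin u / lam).
Proof.
move=> lam0 hP; have [_ [_ [phi [hphi _]]]] := Hu.
apply/ler_addgt0Pr => eta eta0.
have [Q hQ Qle] := kaverage eta0.
have dD : diam K < diam K + 1 by rewrite ltrDl.
suff h : `|fe u P.1 P.2 ^+ 2 - fe u Q.1 Q.2 ^+ 2| <= 3 * (lam * kmass u + kkin u / lam).
  by move: h; rewrite ler_norml => /andP[_ h]; lra.
have -> : 3 * (lam * kmass u + kkin u / lam) = 0 * (diam K + 1)
    + 3 * \sum_(e < ne K) (lam * Int `[0, len e] (fun x => fe u e x ^+ 2)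
           + Int `[0, len e] (fun x => de u e x ^+ 2) / lam).
  by rewrite mul0r add0r big_split/= -mulr_suml -mulr_sumr.
have wle e (x y : R) (h : R -> R) : 0 <= x -> x <= y -> y <= len e ->
    itg `[0, len e] (fun x => h x ^+ 2) ->
    Int `[x, y] (fun x => h x ^+ 2) <= Int `[0, len e] (fun x => h x ^+ 2).
  move=> x0 xy yl hi; apply: Rintegral_subset => //; first exact: sub_itv_edge.
  by move=> *; exact: sqr_ge0.
have lamV : 0 < lam^-1 by rewrite invr_gt0.
apply: (@oscillation_le _ K (fun e x => fe u e x ^+ 2) (fun v => phi v ^+ 2)) => //.
- move=> e; rewrite addr_ge0// mulr_ge0 ?(ltW lam0) ?(ltW lamV)//.
    exact: sobolev_sq_ge0.
  exact: sobolev_deriv2_ge0.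
- by move=> e; case: (hphi e) => ->.
- by move=> e; case: (hphi e) => _ ->.
- move=> e x y x0 xy yl; rewrite mul0r add0r.
  have S := H1_edge e.
  apply: le_trans (sobolev_young S lam0 x0 xy yl) _; apply: lerD.
    rewrite ler_pM2l//; apply: wle => //; exact: (sobolev_sq_integrable S (lexx 0) (lexx _)).
  rewrite ler_pM2r//; apply: wle => //; exact: (sobolev_deriv2_integrable S (lexx 0) (lexx _)).
Qed.

Lemma origin_point : exists2 P, is_point P & fe u P.1 P.2 = fh u 0.
Proof.
have [_ [_ [phi [hphi ->]]]] := Hu.
have [e [->|->]] := vertex_on_edge v0.
  exists (e, 0); first by rewrite /is_point/= lexx ltW// len_pos.
  by case: (hphi e).
exists (e, len e); first by rewrite /is_point/= lexx andbT ltW// len_pos.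
by case: (hphi e).
Qed.

Lemma kpot_le p (B : R) : 2 < p -> (forall P, is_point P -> fe u P.1 P.2 ^+ 2 <= B) ->
  kpot p u <= powR B ((p - 2) / 2) * kmass u.
Proof.
move=> p2 hB; rewrite /kmass mulr_sumr; apply: ler_sum => e _.
have S := H1_edge e; have p0 : 0 <= p by rewrite (le_trans _ (ltW p2)).
rewrite -RintegralZl//; last exact: (sobolev_sq_integrable S (lexx 0) (lexx _)).
apply: le_Rintegral => //.
- exact: (sobolev_powR_integrable S p0 (lexx 0) (lexx _)).
- by apply: integrable_scaleR => //; exact: (sobolev_sq_integrable S (lexx 0) (lexx _)).
- by move=> x; rewrite /= in_itv/= => xe; apply: powR_norm_le => //; exact: (hB (e, x)).
Qed.

End Estimates.

Definition extend_by_zero (f g : R -> R) : gfun K := GFun (fun _ _ => 0) (fun _ _ => 0) f g.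

(** The condition [f 0 = 0] is exactly continuity at [v0] with the zero function on K. *)
Lemma extend_by_zeroP p (f g : R -> R) : 0 < p -> hsobolev f g -> f 0 = 0 ->
  [/\ H1 v0 (extend_by_zero f g), mass (extend_by_zero f g) = hmass f
    & energy p (extend_by_zero f g) = henergy p f g].
Proof.
move=> p0 fg f0.
have z2 e : Int `[0, len (c:=K) e] (fun=> 0 ^+ 2 : R) = 0.
  by rewrite Rintegral_itv_cst ?(ltW (len_pos e))// expr0n/= mul0r.
split.
- split; last split => //.
    move=> e; split; first exact: measurable_cst.
    split; first exact: (integrable_itv_cst 0 (len e) (0 ^+ 2)).
    move=> x /andP[x0 _] /=.
    by have := Rintegral_itv_cst 0 x0; rewrite mul0r => ->; rewrite addr0.
  by exists (fun=> 0); split.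
- rewrite massE /kmass big1 ?add0r// => e _; exact: z2.
- rewrite energyE /kkin /kpot big1; last by move=> e _; exact: z2.
  rewrite big1 ?mulr0 ?subr0 ?add0r// => e _ /=.
  by rewrite Rintegral_itv_cst ?(ltW (len_pos e))// normr0 powR0 ?gt_eqF// mul0r.
Qed.

End GraphFunctions.

(** The gain [y / 2 + 4 * x] exceeds the losses, at most [x + x + y / 4], by at least
    [2 * x + y / 4]. *)
Lemma balance_zero (R : realType) (x y z s t : R) :
  2^-1 * y - z + 4 * x - (s + t) <= 0 -> z <= x -> s <= x -> t <= 4^-1 * y ->
  0 <= x -> 0 <= y -> 4 * x = 0 /\ y = 0.
Proof. by move=> *; split; lra. Qed.

(** * Ground states in natural units and the choice of the threshold *)

Section GroundStates.
Variable R : realType.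
Variable p : R.
Hypothesis p26 : 2 < p < 6.
Local Notation beta := ((p - 2) / (6 - p)).
Local Notation gamma := (1 + 2 * beta).
Local Notation q := ((p - 2) / 2).
Local Notation level := (level p).

Let p2 : 2 < p. Proof. by case/andP: p26. Qed.
Let p6 : p < 6. Proof. by case/andP: p26. Qed.
Let p0 : 0 < p. Proof. exact: lt_trans p2. Qed.
Let q0 : 0 < q. Proof. by move: p2; lra. Qed.
Let q02 : 0 <= q < 2. Proof. by apply/andP; split; move: p2 p6; lra. Qed.

Lemma admissible_nonempty : admissible_energies p !=set0.
Proof.
have [f [g [fg f0 M0 _]]] := exists_bump p26.
have MV : 0 < (hmass f)^-1 by rewrite invr_gt0.
have [w [dw [wd w0 wM _]]] := scaling p26 fg MV.
exists (henergy p w dw), w, dw; split=> //; first exact: w0.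
by rewrite wM mulVf// gt_eqF.
Qed.

Lemma powR_gamma (m : R) : 0 < m -> powR m gamma = m * powR m beta ^+ 2.
Proof.
move=> m0; rewrite gt0_powRD// powRr1 ?(ltW m0)//; congr (_ * _).
by rewrite -powR_mulrn ?powR_ge0// -powRrM (mulrC beta).
Qed.

(** Converts bounds on [u ^ 2] in the unit [m * k] into bounds on the potential in the unit
    [m * k ^ 2]; the exponents agree since [(1 + beta) * q = 2 * beta]. *)
Lemma powR_mass_scale (m : R) : 0 < m -> powR (m * powR m beta) q = powR m beta ^+ 2.
Proof.
move=> m0; rewrite -[X in X * _](powRr1 (ltW m0)) -gt0_powRD//.
rewrite -powR_mulrn ?powR_ge0// -!powRrM; congr (powR _ _).
by field; rewrite subr_eq0 gt_eqF.
Qed.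

Section OneGraph.
Variables (K : cgraph R) (v0 : 'I_(nv K)) (m : R) (u : gfun K).
Hypotheses (m0 : 0 < m) (gs : ground_state v0 p m u).
Let k := powR m beta.
Let k0 : 0 < k. Proof. exact: powR_gt0. Qed.
Let Hu : H1 v0 u. Proof. by case: gs. Qed.
Let T := kkin u + hkin (dh u).

Lemma mass_split : kmass u + hmass (fh u) = m.
Proof. by rewrite -massE; case: gs => _ []. Qed.

(** The competitors are admissible functions, rescaled to mass [m] and extended by zero; the infimum
    is then taken over them. *)
Lemma ground_state_le_level : energy p u <= level * powR m gamma.
Proof.
rewrite -ler_pdivrMr ?powR_gt0//; apply: lb_le_inf; first exact: admissible_nonempty.
move=> _ [f [g [fg f0 f1 ->]]]; rewrite ler_pdivrMr ?powR_gt0//.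
have [w [dw [wd w0 wM wE]]] := scaling p26 fg m0.
have [h1 h2 h3] := extend_by_zeroP v0 p0 wd (w0 f0).
rewrite mulrC -wE -h3; case: gs => _ [_]; apply => //.
by rewrite h2 wM f1 mulr1.
Qed.

(** Nonpositive energy bounds [T] by the potential, hence by the supremum of [u ^ 2]. In natural
    units this is the self-bound for [tau]: the 1 comes from the length of K, and the factor 3 of
    [K_sup_young] is rounded up to 4. *)
Lemma kinetic_a_priori (C : R) : (k * length K)^-1 <= 1 ->
  (forall tau : R, 0 <= tau ->
    (forall t, 0 < t -> tau <= powR (1 + 4 * (t + tau / t)) q) -> tau <= C) ->
  T / (m * k ^+ 2) <= C.
Proof.
move=> kL hC; have L0 := length_gt0 K.
have mk0 : 0 < m * k ^+ 2 by rewrite mulr_gt0// exprn_gt0.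
have MK0 := kmass_ge0 u; have MH0 := hmass_ge0 (fh u); have ms := mass_split.
have TK0 := kkin_ge0 u; have TH0 := hkin_ge0 (dh u).
have T0 : 0 <= T by rewrite addr_ge0.
apply: hC; first by rewrite divr_ge0// ltW.
move=> t t0; set tau := T / _.
have tau0 : 0 <= tau by rewrite divr_ge0// ltW.
have TE : T = tau * (m * k ^+ 2) by rewrite /tau mulfVK// gt_eqF.
(* The parameter is an inverse length, so [t] is dimensionless. *)
pose lam := k * t; have lam0 : 0 < lam by rewrite mulr_gt0.
have lamV : 0 < lam^-1 by rewrite invr_gt0.
pose B := m / length K + 3 * (lam * m + T / lam).
have hTl (x : R) : x <= T -> x / lam <= T / lam by rewrite ler_pM2r.
have hml (x : R) : x <= m -> lam * x <= lam * m by rewrite ler_pM2l.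
have mL : 0 <= m / length K by rewrite divr_ge0// ltW.
have Tl : 0 <= T / lam by rewrite divr_ge0// ltW.
have ml : 0 <= lam * m by rewrite mulr_ge0// ltW.
have BK P : is_point P -> fe u P.1 P.2 ^+ 2 <= B.
  move=> hP; apply: le_trans (K_sup_young Hu lam0 hP) _.
  have h1 : kmass u / length K <= m / length K.
    by rewrite ler_pM2r ?invr_gt0// -ms lerDl.
  have h2 : lam * kmass u <= lam * m by apply: hml; rewrite -ms lerDl.
  have h3 : kkin u / lam <= T / lam by apply: hTl; rewrite lerDl.
  by rewrite /B; lra.
have BH x : 0 <= x -> fh u x ^+ 2 <= B.
  move=> x0; apply: le_trans (hsobolev_sup (H1_halfline Hu) lam0 x0) _.
  have h2 : lam * hmass (fh u) <= lam * m by apply: hml; rewrite -ms lerDr.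
  have h3 : hkin (dh u) / lam <= T / lam by apply: hTl; rewrite lerDr.
  by rewrite /B; lra.
have P1 := kpot_le Hu p2 BK; have P2 := hpot_le p2 (H1_halfline Hu) BH.
have TP : T <= powR B q * m.
  have := ground_state_le_level; rewrite energyE /henergy => hE.
  have neg : level * powR m gamma <= 0.
    by rewrite mulr_le0_ge0 ?powR_ge0// ltW// level_lt0.
  have Pm : kpot p u + hpot p (fh u) <= powR B q * m by rewrite -ms mulrDr lerD.
  have P0 : 0 <= kpot p u + hpot p (fh u) by rewrite addr_ge0 ?kpot_ge0 ?hpot_ge0.
  have pV : p^-1 * (kpot p u + hpot p (fh u)) <= 2^-1 * (kpot p u + hpot p (fh u)).
    by rewrite ler_wpM2r// lef_pV2 ?posrE// ltW.
  rewrite mulrDr in pV; rewrite /T; lra.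
have BE : B = (m * k) * ((k * length K)^-1 + 3 * (t + tau / t)).
  by rewrite /B TE /lam; field; rewrite !gt_eqF.
have tt0 : 0 <= t + tau / t by rewrite addr_ge0 ?divr_ge0// ltW.
have kLV : 0 <= (k * length K)^-1 by rewrite invr_ge0 mulr_ge0// ltW.
have mk : 0 <= m * k by rewrite mulr_ge0// ltW.
have BB : powR B q <= k ^+ 2 * powR (1 + 4 * (t + tau / t)) q.
  rewrite BE powRM//; last by rewrite addr_ge0// mulr_ge0.
  rewrite powR_mass_scale// ler_wpM2l ?sqr_ge0//.
  apply: ge0_ler_powR; rewrite ?nnegrE ?(ltW q0)//.
  - by rewrite addr_ge0// mulr_ge0.
  - by rewrite addr_ge0// mulr_ge0.
  - lra.
rewrite ler_pdivrMr//; apply: le_trans TP _.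
have -> : powR (1 + 4 * (t + tau / t)) q * (m * k ^+ 2) = k ^+ 2 * powR (1 + 4 * (t + tau / t)) q * m by ring.
by rewrite ler_pM2r.
Qed.

(** [X] and [Y] are the mass and kinetic energy on K in natural units, and [sig] bounds [u ^ 2]
    there. The last conclusion compares [u] with the level after its halfline part is prolonged by a
    ramp; [6 * eps * (1 + C0) <= 1] keeps [sig] in the range of the power inequality. *)
Lemma energy_balance (C D eps C0 : R) : diam K < D -> k * D <= eps -> (k * length K)^-1 <= eps ->
  (forall x y : R, 0 <= x <= 1 -> 0 <= y <= 1 -> powR (1 - x + y) gamma <= 1 - x + C * y) ->
  T / (m * k ^+ 2) <= C0 -> 6 * eps * (1 + C0) <= 1 ->
  let X := kmass u / m in let Y := kkin u / (m * k ^+ 2) in let sig := 6 * eps * (X + Y) in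
  [/\ 0 <= X <= 1, 0 <= Y <= C0, 
      forall P, is_point P -> fe u P.1 P.2 ^+ 2 <= m * k * sig &
      2^-1 * Y - powR sig q * X / p - level * X + level * C * sig - sig / 2 <= 0].
Proof.
move=> dD kD kL hC TC0 small X Y sig; have L0 := length_gt0 K.
have mk0 : 0 < m * k ^+ 2 by rewrite mulr_gt0// exprn_gt0.
have mk : 0 < m * k by rewrite mulr_gt0.
have MK0 := kmass_ge0 u; have MH0 := hmass_ge0 (fh u); have ms := mass_split.
have TK0 := kkin_ge0 u; have TH0 := hkin_ge0 (dh u).
have X0 : 0 <= X by rewrite divr_ge0// ltW.
have X1 : X <= 1 by rewrite ler_pdivrMr// mul1r -ms lerDl.
have Y0 : 0 <= Y by rewrite divr_ge0// ltW.
have YC : Y <= C0.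
  by apply: le_trans TC0; rewrite ler_pM2r ?invr_gt0// lerDl.
have KE : kmass u = X * m by rewrite /X mulfVK// gt_eqF.
have TE : kkin u = Y * (m * k ^+ 2) by rewrite /Y mulfVK// gt_eqF.
have eps0 : 0 <= eps.
  by apply: le_trans kD; rewrite mulr_ge0 ?(ltW k0)// (le_trans (diam_ge0 K))// ltW.
have sig0 : 0 <= sig by rewrite !mulr_ge0// addr_ge0.
have sig1 : sig <= 1.
  by apply: le_trans small; rewrite ler_wpM2l ?mulr_ge0// lerD.
have supK P : is_point P -> fe u P.1 P.2 ^+ 2 <= m * k * sig.
  move=> hP; apply: le_trans (K_sup_diam Hu dD hP) _.
  have -> : 2 * (kmass u / length K) + 6 * (D * kkin u) =
     m * k * (2 * ((k * length K)^-1 * X) + 6 * (k * D * Y)).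
    by rewrite KE TE; field; rewrite !gt_eqF.
  rewrite ler_pM2l//.
  have h1 : (k * length K)^-1 * X <= eps * X by rewrite ler_wpM2r.
  have h2 : k * D * Y <= eps * Y by rewrite ler_wpM2r.
  have h3 : 0 <= eps * X by rewrite mulr_ge0.
  by rewrite /sig mulrDr -!mulrA; lra.
split=> //; [by rewrite X0 | by rewrite Y0 |].
have PK := kpot_le Hu p2 supK.
have [P0 hP0 P0E] := origin_point Hu.
set a2 := fh u 0 ^+ 2.
have a2le : a2 <= m * k * sig by rewrite /a2 -P0E supK.
(* A ramp of length [1 / k] adds mass at most [m * sig] and energy at most [m * k ^ 2 * sig / 2]. *)
have kV : 0 < k^-1 by rewrite invr_gt0.
have ramp := level_le_ramp p26 (H1_halfline Hu) kV; rewrite -/a2 in ramp.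
have lev := level_lt0 p26.
have G : powR m gamma = m * k ^+ 2 by exact: powR_gamma.
have g0 : 0 <= gamma := le_trans ler01 (gamma_ge1 p26).
have a20 : 0 <= a2 by exact: sqr_ge0.
have pw : powR (hmass (fh u) + a2 * k^-1) gamma <= m * k ^+ 2 * (1 - X + C * sig).
  apply: (@le_trans _ _ (powR (m * (1 - X + sig)) gamma)).
    apply: ge0_ler_powR => //; rewrite ?nnegrE.
    - by rewrite addr_ge0// mulr_ge0// ltW.
    - by rewrite mulr_ge0 ?(ltW m0)// addr_ge0// subr_ge0.
    - have -> : m * (1 - X + sig) = hmass (fh u) + m * sig.
        have -> : hmass (fh u) = m - X * m.
          by apply/eqP; rewrite eq_sym subr_eq addrC -KE ms.
        by ring.
      rewrite lerD2l ler_pdivrMr//; apply: le_trans a2le _.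
      by rewrite mulrAC.
  rewrite powRM ?(ltW m0)//; last by rewrite addr_ge0// subr_ge0.
  by rewrite G ler_wpM2l ?(ltW mk0)//; apply: hC; rewrite ?X0 ?X1 ?sig0 ?sig1.
have pw' : level * (m * k ^+ 2 * (1 - X + C * sig)) <= level * powR (hmass (fh u) + a2 * k^-1) gamma.
  by rewrite ler_wnM2l// ltW.
have aE : a2 / (2 * k^-1) <= m * k ^+ 2 * (sig / 2).
  have -> : a2 / (2 * k^-1) = k / 2 * a2 by field; rewrite gt_eqF.
  have -> : m * k ^+ 2 * (sig / 2) = k / 2 * (m * k * sig) by ring.
  by rewrite ler_pM2l// divr_gt0.
have PK' : p^-1 * kpot p u <= m * k ^+ 2 * (powR sig q * X / p).
  apply: (@le_trans _ _ (p^-1 * (powR (m * k * sig) q * kmass u))).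
    by rewrite ler_pM2l// invr_gt0.
  rewrite powRM ?(ltW mk)// powR_mass_scale// KE.
  by rewrite le_eqVlt; apply/orP; left; apply/eqP; rewrite /k; ring.
have := ground_state_le_level; rewrite energyE G TE => hE.
rewrite -(pmulr_rle0 _ mk0).
have -> : m * k ^+ 2 * (2^-1 * Y - powR sig q * X / p - level * X + level * C * sig - sig / 2)
  = 2^-1 * (Y * (m * k ^+ 2)) - m * k ^+ 2 * (powR sig q * X / p)
    + level * (m * k ^+ 2 * (1 - X + C * sig)) - m * k ^+ 2 * (sig / 2) - level * (m * k ^+ 2).
  by ring.
lra.
Qed.

End OneGraph.

Lemma no_ground_state : exists eps : R, 0 < eps /\
    forall (K : cgraph R) (v0 : 'I_(nv K)) (m : R),
      0 < m ->
      powR m beta * diam K + (powR m beta * length K)^-1 < eps ->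
      ~ exists u : gfun K, ground_state v0 p m u.
Proof.
have [C0 C01 hC0] := sublinear_fixpoint_bound q02.
have [C C1 hC] := powR_le_linear (gamma_ge1 p26).
have lev := level_lt0 p26; pose th := - level; have th0 : 0 < th by rewrite oppr_gt0.
(* If [sig <= ka], the potential on K costs at most a quarter of the gain [th * X]. *)
pose ka := powR (p * th / 4) q^-1.
have pth : 0 < p * th / 4 by rewrite !mulr_gt0.
have ka0 : 0 < ka by exact: powR_gt0.
have kaE : powR ka q = p * th / 4 by rewrite -powRrM mulVf ?gt_eqF// powRr1// ltW.
have kaV : 0 < ka^-1 by rewrite invr_gt0.
have thV : 0 < th^-1 by rewrite invr_gt0.
have C0p : 0 < 6 * (1 + C0) by rewrite mulr_gt0// addr_gt0// (lt_le_trans _ C01).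
have Cp : 0 < 6 * (th * C + 2^-1).
  by rewrite mulr_gt0// addr_gt0 ?invr_gt0// mulr_gt0// (lt_le_trans _ C1).
(* One summand for each of the smallness conditions [e1] to [e5], so that [eps = 1 / N] meets them
   all. *)
pose N := 1 + 6 * (1 + C0) + 6 * (1 + C0) / ka + 6 * (th * C + 2^-1) * (4 / th) + 6 * (th * C + 2^-1) * 4.
have n1 : 0 < 6 * (1 + C0) / ka by rewrite mulr_gt0.
have n2 : 0 < 6 * (th * C + 2^-1) * (4 / th) by rewrite mulr_gt0// mulr_gt0.
have n3 : 0 < 6 * (th * C + 2^-1) * 4 by rewrite mulr_gt0.
have N0 : 0 < N by rewrite /N; lra.
pose eps := N^-1; have eps0 : 0 < eps by rewrite invr_gt0.
have epsE (x : R) : x <= N -> eps * x <= 1.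
  by move=> xN; rewrite -[leRHS](mulVf (lt0r_neq0 N0)) ler_pM2l.
have e1 : eps <= 1 by rewrite -[leLHS]mulr1; apply: epsE; rewrite /N; lra.
have e2 : 6 * eps * (1 + C0) <= 1.
  by rewrite -mulrA mulrCA; apply: epsE; rewrite /N; lra.
have e3 : 6 * eps * (1 + C0) <= ka.
  rewrite -[leRHS]mul1r -ler_pdivrMr//.
  have -> : 6 * eps * (1 + C0) / ka = eps * (6 * (1 + C0) / ka) by ring.
  by apply: epsE; rewrite /N; lra.
have e4 : 6 * eps * (th * C + 2^-1) <= th / 4.
  have -> : th / 4 = 1 * (th / 4) by rewrite mul1r.
  rewrite -ler_pdivrMr ?divr_gt0// invf_div.
  have -> : 6 * eps * (th * C + 2^-1) * (4 / th) = eps * (6 * (th * C + 2^-1) * (4 / th)) by ring.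
  by apply: epsE; rewrite /N; lra.
have e5 : 6 * eps * (th * C + 2^-1) <= 4^-1.
  rewrite -[leRHS]mul1r -ler_pdivrMr ?invr_gt0// invrK.
  have -> : 6 * eps * (th * C + 2^-1) * 4 = eps * (6 * (th * C + 2^-1) * 4) by ring.
  by apply: epsE; rewrite /N; lra.
exists eps; split => // K v0 m m0 hyp [u gs].
set k := powR m beta in hyp; have k0 : 0 < k by exact: powR_gt0.
have L0 := length_gt0 K; have d0 := diam_ge0 K.
have kLV : 0 < (k * length K)^-1 by rewrite invr_gt0 mulr_gt0.
(* The diameter receives the room that the length term leaves below [eps]; the strict hypothesis
   yields [diam K < D]. *)
pose D := (eps - (k * length K)^-1) / k.
have dD : diam K < D by rewrite /D ltr_pdivlMr// mulrC ltrBrDr.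
have kD : k * D <= eps by rewrite /D mulrC mulfVK ?gt_eqF// gerBl ltW.
have kL : (k * length K)^-1 <= eps.
  by apply: le_trans (ltW hyp); rewrite lerDr mulr_ge0// ltW.
have TC := kinetic_a_priori m0 gs (le_trans kL e1) hC0.
have [] := energy_balance m0 gs dD kD kL hC TC e2.
rewrite -/k; set X := kmass u / m; set Y := kkin u / _; set sig := 6 * eps * (X + Y).
move=> /andP[X0 X1] /andP[Y0 Y1] supK bal.
have mk0 : 0 < m * k ^+ 2 by rewrite mulr_gt0// exprn_gt0.
have sig0 : 0 <= sig by rewrite !mulr_ge0// ?(ltW eps0)// addr_ge0.
have sigka : sig <= ka.
  by apply: le_trans e3; rewrite ler_wpM2l ?mulr_ge0 ?(ltW eps0)// lerD.
have sq : powR sig q * X / p <= th / 4 * X.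
  have -> : powR sig q * X / p = powR sig q * (X / p) by ring.
  have -> : th / 4 * X = p * th / 4 * (X / p) by field; rewrite gt_eqF.
  apply: ler_wpM2r; first by rewrite divr_ge0// ltW.
  rewrite -kaE.
  by apply: ge0_ler_powR => //; [exact: ltW | rewrite nnegrE ltW].
have s1 : 6 * eps * (th * C + 2^-1) * X <= th / 4 * X by rewrite ler_wpM2r.
have s2 : 6 * eps * (th * C + 2^-1) * Y <= 4^-1 * Y by rewrite ler_wpM2r.
have balE : 2^-1 * Y - powR sig q * X / p - level * X + level * C * sig - sig / 2
   = 2^-1 * Y - powR sig q * X / p + th * X
     - (6 * eps * (th * C + 2^-1) * X + 6 * eps * (th * C + 2^-1) * Y).
  by rewrite /sig /th; ring.
rewrite balE in bal.
have thX : 0 <= th * X by rewrite mulr_ge0// ltW.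
have XY : th * X = 0 /\ Y = 0.
  have -> : th * X = 4 * (th / 4 * X) by field.
  have thX4 : 0 <= th / 4 * X by rewrite mulr_ge0// divr_ge0// ltW.
  have bal' : 2^-1 * Y - powR sig q * X / p + 4 * (th / 4 * X)
     - (6 * eps * (th * C + 2^-1) * X + 6 * eps * (th * C + 2^-1) * Y) <= 0.
    by move: bal; rewrite (_ : th * X = 4 * (th / 4 * X))//; field.
  exact: balance_zero bal' sq s1 s2 thX4 Y0.
have [thX0 Yz] := XY.
have Xz : X = 0 by move/eqP: thX0; rewrite mulf_eq0 gt_eqF//= => /eqP.
have sigz : sig = 0 by rewrite /sig Xz Yz addr0 mulr0.
have MK : kmass u = 0.
  by rewrite -(mulfVK (lt0r_neq0 m0) (kmass u)) -/X Xz mul0r.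
have TK : kkin u = 0.
  by rewrite -(mulfVK (lt0r_neq0 mk0) (kkin u)) -/Y Yz mul0r.
have Hu : H1 v0 u by case: gs.
have PK : kpot p u = 0.
  apply/le_anti; rewrite kpot_ge0 andbT.
  by have := kpot_le Hu p2 supK; rewrite MK mulr0.
have [P hP PE] := origin_point Hu.
have a0 : fh u 0 = 0.
  apply/eqP; rewrite -sqrf_eq0 eq_le sqr_ge0 andbT -PE.
  by have := supK P hP; rewrite sigz mulr0.
have mH := mass_split gs; rewrite MK add0r in mH.
(* Nothing is left on K, so the halfline part has mass [m], vanishes at the origin and attains the
   level. *)
have := ground_state_le_level m0 gs; rewrite energyE TK PK !mulr0 subr0 add0r -mH.
by rewrite leNgt level_not_attained// ?mH//; exact: H1_halfline Hu.
Qed.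

End GroundStates.

Theorem theorem6p4 (R : realType) (p : R) :
  2 < p < 6 ->
  let beta := (p - 2) / (6 - p) in
  exists eps : R, 0 < eps /\
    forall (K : cgraph R) (v0 : 'I_(nv K)) (m : R),
      0 < m ->
      powR m beta * diam K + (powR m beta * length K)^-1 < eps ->
      ~ exists u : gfun K, ground_state v0 p m u.
Proof. exact: no_ground_state. Qed.
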